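(* Let $k\geq 2$ and let $(\Sigma_k,\sigma)$ be the full one-sided shift on $k$ symbols. Suppose $\varphi:\Sigma_k\to\mathbb{R}$ is continuous and $I_\varphi(\sigma)\neq\emptyset$. Then for any $a\in\operatorname{Int}(L_\varphi(\sigma))$ and each $i\in\{1,\dots,6\}$, the set $\{x\in Rec(\Sigma_k)\setminus BR(\Sigma_k): x \text{ satisfies Case }(i')\}$ contains an uncountable DC1-scrambled subset contained in $I_\varphi(\sigma)$, an uncountable DC1-scrambled subset contained in $R_\varphi(a)$, and an uncountable DC1-scrambled subset contained in $R_\varphi$.
   Context: $\Sigma_k=\{0,1,\dots,k-1\}^{\mathbb{N}}$ with metric $d(x,y)=\sum_{n\ge1}\delta(x_n,y_n)/2^n$ ($\delta(a,b)=0$ if $a=b$, $1$ otherwise) and shift $\sigma$. $N(x,U)=\{n\ge1:\sigma^n(x)\in U\}$. For $S\subseteq\mathbb{N}$: $\overline d,\underline d$ are upper/lower asymptotic densities and $B^*,B_*$ are Banach upper/lower densities (limsup/liminf of $|S\cap I|/|I|$ over intervals $I$ of consecutive integers with $|I|\to\infty$). $x\in Rec$ if $N(x,B_\varepsilon(x))\ne\emptyset$ for all $\varepsilon>0$; $x\in BR$ if $B^*(N(x,B_\varepsilon(x)))>0$ for all $\varepsilon>0$. For $\xi\in\{\overline d,\underline d,B^*,B_*\}$, $\omega_\xi(x)=\{y:\xi(N(x,B_\varepsilon(y)))>0\ \forall\varepsilon>0\}$; $\omega_\sigma(x)$ is the $\omega$-limit set. Cases: (1') $\omega_{B_*}\subsetneq\omega_{\underline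 d}=\omega_{\overline d}=\omega_{B^*}\subsetneq\omega_\sigma$; (2') $\omega_{B_*}\subsetneq\omega_{\underline d}=\omega_{\overline d}\subsetneq\omega_{B^*}\subsetneq\omega_\sigma$; (3') $\omega_{B_*}=\omega_{\underline d}\subsetneq\omega_{\overline d}=\omega_{B^*}\subsetneq\omega_\sigma$; (4') $\omega_{B_*}\subsetneq\omega_{\underline d}\subsetneq\omega_{\overline d}=\omega_{B^*}\subsetneq\omega_\sigma$; (5') $\omega_{B_*}=\omega_{\underline d}\subsetneq\omega_{\overline d}\subsetneq\omega_{B^*}\subsetneq\omega_\sigma$; (6') $\omega_{B_*}\subsetneq\omega_{\underline d}\subsetneq\omega_{\overline d}\subsetneq\omega_{B^*}\subsetneq\omega_\sigma$ (all sets evaluated at $x$). DC1 pair: $\liminf_n\frac1n|\{0\le i<n:d(\sigma^ix,\sigma^iy)<s\}|=0$ for some $s>0$ and $\limsup_n\frac1n|\{0\le i<n:d(\sigma^ix,\sigma^iy)<t\}|=1$ for all $t>0$; a DC1-scrambled set has at least two points and every pair of distinct points is DC1. $I_\varphi(\sigma)$ is the set of $x$ for which $\frac1n\sum_{i=0}^{n-1}\varphi(\sigma^ix)$ diverges; $L_\varphi(\sigma)=[\inf_\mu\int\varphi\,d\mu,\sup_\mu\int\varphi\,d\mu]$ over $\sigma$-invariant Borel probability measures $\mu$, $\operatorname{Int}(L_\varphi(\sigma))$ its open interior interval; $R_\varphi(a)=\{x:\lim_n\frac1n\sum_{i=0}^{n-1}\varphi(\sigma^ix)=a\}$ and $R_\varphi=\bigcup_{a\in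 L_\varphi(\sigma)}R_\varphi(a)$. *)

(* Defs.v *)
From HB Require Import structures.
From mathcomp Require Import all_boot all_order all_algebra.
From mathcomp Require Import all_classical all_reals all_analysis.

Set Implicit Arguments.
Unset Strict Implicit.
Unset Printing Implicit Defensive.

Import Order.TTheory GRing.Theory Num.Theory numFieldNormedType.Exports.
Local Open Scope classical_set_scope.
Local Open Scope ring_scope.

(* The alphabet {0,...,k-1} is 'I_(k.-1).+1, which has exactly k elements   *)
(* as soon as k >= 1 (the theorem assumes k >= 2).  We use this spelling    *)
(* (rather than 'I_k) only so that the sequence space is inhabited for      *)
(* every k, which MathComp-Analysis requires to build a measurable space.   *)
(* A point x of Sigma_k is x : nat -> Alph k, its n-th coordinate (the      *)
(* paper's x_{n+1}) being x n.                                              *)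
Definition Alph (k : nat) := 'I_(k.-1).+1.
Definition Sigma (k : nat) := nat -> Alph k.

HB.instance Definition _ k := gen_eqMixin (Sigma k).
HB.instance Definition _ k := gen_choiceMixin (Sigma k).
HB.instance Definition _ (k : nat) :=
  isPointed.Build (Sigma k) (fun _ => ord0).

Definition shift (k : nat) (x : Sigma k) : Sigma k := fun n => x n.+1.

Definition shiftn (k : nat) (n : nat) (x : Sigma k) : Sigma k :=
  fun m => x (n + m)%N.

Section Defs.
Variable R : realType.
Variable k : nat.

Definition dist (x y : Sigma k) : R :=
  limn (series (fun n : nat => ((x n != y n)%:R / 2 ^+ n.+1 : R))).

Definition ball_d (y : Sigma k) (eps : R) : set (Sigma k) :=
  [set x | dist x y < eps].

Definition d_continuous (phi : Sigma k -> R) : Prop :=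
  forall x (eps : R), 0 < eps -> exists2 delta : R, 0 < delta &
    forall y, dist x y < delta -> `|phi y - phi x| < eps.

Definition d_open (U : set (Sigma k)) : Prop :=
  forall x, U x -> exists2 eps : R, 0 < eps & ball_d x eps `<=` U.

Definition SigmaB : measurableType (sigma_display d_open) :=
  g_sigma_algebraType d_open.

Definition shift_invariant (mu : probability SigmaB R) : Prop :=
  forall A : set SigmaB, measurable A ->
    mu ((@shift k : SigmaB -> SigmaB) @^-1` A) = mu A.

Definition integrals_phi (phi : Sigma k -> R) : set (\bar R) :=
  [set (\int[mu]_x (phi x)%:E)%E |
     mu in [set mu : probability SigmaB R | shift_invariant mu]].

Definition Linf (phi : Sigma k -> R) : \bar R := ereal_inf (integrals_phi phi).
Definition Lsup (phi : Sigma k -> R) : \bar R := ereal_sup (integrals_phi phi).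

Definition in_L (phi : Sigma k -> R) (a : R) : Prop :=
  (Linf phi <= a%:E <= Lsup phi)%E.
Definition in_IntL (phi : Sigma k -> R) (a : R) : Prop :=
  (Linf phi < a%:E < Lsup phi)%E.

Definition birkhoff (phi : Sigma k -> R) (x : Sigma k) (n : nat) : R :=
  n%:R^-1 * \sum_(i < n) phi (shiftn i x).

Definition I_phi (phi : Sigma k -> R) : set (Sigma k) :=
  [set x | ~ (exists l : R, birkhoff phi x @ \oo --> l)].

Definition R_phi_a (phi : Sigma k -> R) (a : R) : set (Sigma k) :=
  [set x | birkhoff phi x @ \oo --> a].

Definition R_phi (phi : Sigma k -> R) : set (Sigma k) :=
  \bigcup_(a in [set a | in_L phi a]) R_phi_a phi a.

Definition count_in (S : set nat) (m n : nat) : R :=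
  \sum_(m <= i < m + n) (if `[< S i >] then 1 else 0).

Definition upper_dens (S : set nat) : \bar R :=
  limn_esup (fun n : nat => (count_in S 1 n / n%:R)%:E).
Definition lower_dens (S : set nat) : \bar R :=
  limn_einf (fun n : nat => (count_in S 1 n / n%:R)%:E).

Definition banach_upper (S : set nat) : \bar R :=
  limn_esup (fun n : nat =>
    ereal_sup [set (count_in S m.+1 n / n%:R)%:E | m in [set: nat]]).
Definition banach_lower (S : set nat) : \bar R :=
  limn_einf (fun n : nat =>
    ereal_inf [set (count_in S m.+1 n / n%:R)%:E | m in [set: nat]]).

Definition visits (x : Sigma k) (U : set (Sigma k)) : set nat :=
  [set n | (1 <= n)%N /\ U (shiftn n x)].

Definition Rec : set (Sigma k) :=
  [set x | forall eps : R, 0 < eps -> visits x (ball_d x eps) !=set0].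
Definition BR : set (Sigma k) :=
  [set x | forall eps : R, 0 < eps ->
     (0 < banach_upper (visits x (ball_d x eps)))%E].

Definition omega_dens (xi : set nat -> \bar R) (x : Sigma k) : set (Sigma k) :=
  [set y | forall eps : R, 0 < eps -> (0 < xi (visits x (ball_d y eps)))%E].

Definition omega_lim (x : Sigma k) : set (Sigma k) :=
  [set y | forall (eps : R) (N : nat), 0 < eps ->
     exists2 n, (N <= n)%N & ball_d y eps (shiftn n x)].

Definition proper_sub (A B : set (Sigma k)) : Prop := A `<=` B /\ A <> B.

Definition case_prop (i : nat) (x : Sigma k) : Prop :=
  let wBl := omega_dens banach_lower x in
  let wdl := omega_dens lower_dens x in
  let wdu := omega_dens upper_dens x in
  let wBu := omega_dens banach_upper x in
  let ws := omega_lim x in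
  match i with
  | 1 => [/\ proper_sub wBl wdl, wdl = wdu, wdu = wBu & proper_sub wBu ws]
  | 2 => [/\ proper_sub wBl wdl, wdl = wdu, proper_sub wdu wBu
           & proper_sub wBu ws]
  | 3 => [/\ wBl = wdl, proper_sub wdl wdu, wdu = wBu & proper_sub wBu ws]
  | 4 => [/\ proper_sub wBl wdl, proper_sub wdl wdu, wdu = wBu
           & proper_sub wBu ws]
  | 5 => [/\ wBl = wdl, proper_sub wdl wdu, proper_sub wdu wBu
           & proper_sub wBu ws]
  | 6 => [/\ proper_sub wBl wdl, proper_sub wdl wdu, proper_sub wdu wBu
           & proper_sub wBu ws]
  | _ => False
  end.

Definition close_freq (x y : Sigma k) (s : R) (n : nat) : R :=
  n%:R^-1 * \sum_(i < n) (if dist (shiftn i x) (shiftn i y) < s then 1 else 0).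

Definition DC1_pair (x y : Sigma k) : Prop :=
  (exists2 s : R, 0 < s & limn_einf (fun n => (close_freq x y s n)%:E) = 0%E)
  /\ (forall t : R, 0 < t ->
        limn_esup (fun n => (close_freq x y t n)%:E) = 1%E).

Definition DC1_scrambled (S : set (Sigma k)) : Prop :=
  (exists x y, [/\ S x, S y & x <> y]) /\
  (forall x y, S x -> S y -> x <> y -> DC1_pair x y).

End Defs.

(* Main.v *)
(** Let [al < a < be] be such that some words U and V have Birkhoff averages
    at most [al], resp. at least [be], whatever follows them.  A hierarchy of
    words A' = A^p B^(M-p), with p chosen by a discrete intermediate value
    argument, converges to a uniformly recurrent sequence with any prescribed
    uniform average in ]al, be[ and with an arbitrarily long prefix of U.
    Since long prefixes of U cannot occur in a sequence whose uniform average
    exceeds [al], three such sequences z_0, z_1, z_2 can be given pairwise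
    disjoint orbit closures Z_0, Z_1, Z_2.

    The points x begin with a prefix of U that occurs in no z_t, and then
    follow longer and longer pieces of z_0, z_1, z_2 along stages [N_j, N_{j+1}[
    with N_{j+1} / N_j -> oo; a copy of x[0, N_{j-1}[ at N_j makes x recurrent.
    The places where x does not follow some z_t (the glitches) have zero Banach
    density, so x is not Banach recurrent, and for each of the four densities
    omega_xi(x) is the union of those Z_t such that the times of type t have
    positive density.  The six cases correspond to six patterns of types, and
    the Birkhoff averages of x are governed by the averages of z_0 and z_1,
    which are chosen equal (convergence) or distinct (divergence).  Finally, on
    infinitely many stages x follows the shifted sequence sigma(z_t) instead of
    z_t if a bit of a parameter in {0,1}^N is set: two points with distinct
    parameters are far apart along these stages, and they agree along the other
    ones. *)
Require Import Defs.
From HB Require Import structures.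
From mathcomp Require Import all_boot all_order all_algebra.
From mathcomp Require Import all_classical all_reals all_analysis.
From mathcomp Require Import measurable_realfun.
From mathcomp Require Import ring lra zify.

Set Implicit Arguments.
Unset Strict Implicit.
Unset Printing Implicit Defensive.

Import Order.TTheory GRing.Theory Num.Theory numFieldNormedType.Exports.
Local Open Scope classical_set_scope.
Local Open Scope ring_scope.

(** * The metric and uniform continuity *)

Definition agree (k h : nat) (x y : Sigma k) := forall i, (i < h)%N -> x i = y i.

Section Metric.
Variables (R : realType) (k : nat).
Implicit Types x y z : Sigma k.

Lemma agree_sym h x y : agree h x y -> agree h y x.
Proof. by move=> H i ih; rewrite H. Qed.

Lemma agree_trans h x y z : agree h x y -> agree h y z -> agree h x z.
Proof. by move=> H1 H2 i ih; rewrite H1 ?H2. Qed.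

Lemma agreeS h h' x y : (h <= h')%N -> agree h' x y -> agree h x y.
Proof. by move=> hh H i ih; apply: H; exact: leq_trans hh. Qed.

Lemma shiftnD m n x : shiftn m (shiftn n x) = shiftn (n + m) x.
Proof. by apply/funext => i; rewrite /shiftn addnA. Qed.

Lemma shiftn0 x : shiftn 0 x = x.
Proof. by []. Qed.

Lemma agree_shiftn m h x y : agree (m + h) x y -> agree h (shiftn m x) (shiftn m y).
Proof. by move=> H i ih; apply: H; rewrite ltn_add2l. Qed.

Let term x y (n : nat) : R := (x n != y n)%:R / 2 ^+ n.+1.

Let term_ge0 x y n : 0 <= term x y n.
Proof. by rewrite divr_ge0 ?ler0n// exprn_ge0. Qed.

Let dist_series_nd x y : nondecreasing_seq (series (term x y)).
Proof.
apply/nondecreasing_seqP => n; rewrite seriesSr lerDl; exact: term_ge0.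
Qed.

(** Coordinates in agreement contribute nothing and the later ones at most a geometric tail; keeping
    the remainder [2 ^- (h + n)] lets the induction close. *)
Let dist_series_le h x y n : agree h x y ->
  series (term x y) (h + n)%N <= 2 ^- h - 2 ^- (h + n)%N.
Proof.
move=> H; elim: n => [|n IH].
  rewrite addn0 subrr /series /= big_nat_cond big1// => i /andP[/andP[_ ih] _].
  by rewrite /term (H _ ih) eqxx mul0r.
rewrite addnS seriesSr; apply: le_trans (lerD IH (_ : _ <= 2 ^- (h + n)%N.+1)) _.
  by rewrite /term; case: (_ != _); rewrite /= ?mul1r// mul0r invr_ge0 exprn_ge0.
rewrite -addrA lerD2l exprS invfM; set e := 2 ^- _; lra.
Qed.

Let dist_cvg x y : cvgn (series (term x y)).
Proof.
apply: nondecreasing_is_cvgn; first exact: dist_series_nd.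
exists 1 => _ [n _ <-]; have := @dist_series_le 0 x y n.
rewrite add0n expr0 invr1 => /(_ (fun i H => False_ind _ (notF H))).
by move/le_trans; apply; rewrite gerBl invr_ge0 exprn_ge0.
Qed.

Lemma dist_le h x y : agree h x y -> dist R x y <= 2 ^- h.
Proof.
move=> H; apply: limr_le; first exact: dist_cvg.
near=> n; apply: le_trans (dist_series_nd _ _ (leq_addl h n)) _.
by apply: le_trans (dist_series_le n H) _; rewrite gerBl invr_ge0 exprn_ge0.
Unshelve. all: by end_near. Qed.

Lemma agree_dist h x y : dist R x y < 2 ^- h -> agree h x y.
Proof.
move=> H i ih; apply/eqP; apply: contraLR H => xy; rewrite -leNgt.
apply: le_trans (nondecreasing_cvgn_le (dist_series_nd x y) (@dist_cvg x y) i.+1).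
rewrite seriesSr; apply: le_trans (_ : term x y i <= _); last first.
  by rewrite lerDr sumr_ge0// => j _; exact: term_ge0.
rewrite /term xy mul1r lef_pV2 ?posrE ?exprn_gt0//.
by rewrite ler_weXn2l// ler1n.
Qed.

Lemma exists_pow_lt (e : R) : 0 < e -> exists h : nat, 2 ^- h < e.
Proof.
move=> e0; exists (Num.truncn e^-1).
have := truncnS_gt e^-1 => H.
rewrite invf_plt ?posrE ?exprn_gt0//; apply: lt_le_trans H _.
by rewrite -natrX ler_nat ltn_expl.
Qed.

Lemma ball_agree (y : Sigma k) (e : R) : 0 < e ->
  exists h, forall x, agree h x y -> ball_d y e x.
Proof.
move=> /exists_pow_lt[h he]; exists h => x /dist_le xy.
by apply: le_lt_trans he.
Qed.

Section UnifCont.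
Variable phi : Sigma k -> R.
Hypothesis hphi : d_continuous phi.

(* Koenig's lemma: if no modulus worked, the words [w] below which every   *)
(* modulus fails would form an infinite finitely branching tree.            *)
Lemma unif_cont (e : R) : 0 < e ->
  exists h, forall x y, agree h x y -> `|phi x - phi y| < e.
Proof.
move=> e0; apply: contrapT => /forallNP nouc.
pose bad (n : nat) (w : Sigma k) := forall h, exists x y,
  [/\ agree n w x, agree h x y & e <= `|phi x - phi y|].
have bad0 w : bad 0 w.
  move=> h; have /existsNP[x /existsNP[y /not_implyP[xy /negP]]] := nouc h.
  by rewrite -leNgt => exy; exists x, y.
(* If each one-letter extension of [w] had a modulus, the largest of these finitely many moduli
   would serve for [w]. *)
have badS n w : bad n w -> exists w', bad n.+1 w' /\ agree n w w'.
  move=> bw; apply: contrapT => /forallNP nb.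
  pose up (c : Alph k) : Sigma k := fun i => if (i < n)%N then w i else c.
  have H c : exists h, forall x y, agree n.+1 (up c) x -> agree h x y ->
      `|phi x - phi y| < e.
    have /not_andP[/existsNP[h Hh]|] := nb (up c); last first.
      by case=> i ii; rewrite /up ii.
    exists h => x y ux xy; rewrite ltNge; apply/negP => exy.
    by apply: Hh; exists x, y.
  have [f Hf] := choice H.
  have [x [y [wx xy]]] := bw (\max_(c : Alph k) f c)%N.
  rewrite leNgt; apply/negP; rewrite negbK; apply: (Hf (x n)).
    by move=> i; rewrite ltnS leq_eqVlt /up => /predU1P[->|ii]; rewrite ?ltnn// ii wx.
  by apply: agreeS xy; exact: leq_bigmax.
have bg n w : {w' | bad n w -> bad n.+1 w' /\ agree n w w'}.
  by apply/cid; have [/badS[w' ?]|?] := pselect (bad n w); [exists w'|exists w].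
pose g n w := sval (bg n w).
have Hg n w : bad n w -> bad n.+1 (g n w) /\ agree n w (g n w) by exact: svalP (bg n w).
pose ws := fix ws n := if n is m.+1 then g m (ws m) else (fun=> ord0 : Alph k).
have bws n : bad n (ws n) by elim: n => [|n /Hg[]//]; exact: bad0.
have aws n m : (n <= m)%N -> agree n (ws n) (ws m).
  move=> /subnK<-; elim: (m - n)%N => // d IH; rewrite addSn.
  by apply: agree_trans IH _; apply: agreeS (Hg _ _ (bws _)).2; exact: leq_addl.
(* The infinite branch: continuity at [w] with tolerance [e / 2] contradicts a bad pair that agrees
   with [w] on [h] letters. *)
pose w : Sigma k := fun i => ws i.+1 i.
have wws n : agree n w (ws n) by move=> i ii; rewrite /w; apply: aws.
have [d d0 Hd] := hphi w (divr_gt0 e0 (ltr0Sn R 1)).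
have [h hd] := exists_pow_lt d0.
have [x [y [wx xy exy]]] := bws h h.
have ax : agree h w x by apply: agree_trans wx; exact: wws.
have /Hd X : dist R w x < d by apply: le_lt_trans hd; exact: dist_le.
have /Hd Y : dist R w y < d.
  by apply: le_lt_trans hd; apply: dist_le; exact: agree_trans xy.
move: exy; rewrite leNgt => /negP; apply.
have -> : phi x - phi y = (phi x - phi w) - (phi y - phi w) by ring.
by apply: le_lt_trans (ler_normB _ _) _; lra.
Qed.

(** Up to an error 1 the value depends on the first [h] letters only, and there are finitely many
    words of that length. *)
Lemma phi_bounded : exists C : R, 0 < C /\ forall x, `|phi x| <= C.
Proof.
have [h Hh] := unif_cont ltr01.
pose ext (t : h.-tuple (Alph k)) : Sigma k := nth ord0 t.
exists (1 + \sum_t `|phi (ext t)|); split.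
  by rewrite ltr_pwDl// sumr_ge0.
move=> x; pose t := [tuple x i | i < h].
have /Hh H : agree h x (ext t).
  by move=> i ih; rewrite /ext -[i]/(nat_of_ord (Ordinal ih)) -tnth_nth tnth_mktuple.
have -> : phi x = (phi x - phi (ext t)) + phi (ext t) by ring.
apply: le_trans (ler_normD _ _) _; rewrite lerD ?(ltW H)//.
by rewrite (bigD1 t)//= lerDl sumr_ge0.
Qed.

End UnifCont.
End Metric.
(** * Birkhoff sums and invariant measures *)

Section BirkhoffSum.
Variables (R : realType) (k : nat) (phi : Sigma k -> R).

Definition birk_sum (x : Sigma k) (n : nat) : R := \sum_(i < n) phi (shiftn i x).

Lemma BSS x n : birk_sum x n.+1 = birk_sum x n + phi (shiftn n x).
Proof. by rewrite /birk_sum big_ord_recr. Qed.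

Lemma BS0 x : birk_sum x 0 = 0. Proof. by rewrite /birk_sum big_ord0. Qed.

Lemma BSD x m n : birk_sum x (m + n) = birk_sum x m + birk_sum (shiftn m x) n.
Proof.
rewrite /birk_sum big_split_ord /=; congr (_ + _).
by apply: eq_bigr => i _; rewrite shiftnD.
Qed.

End BirkhoffSum.

Section Invariant.
Variables (R : realType) (k : nat) (phi : Sigma k -> R).
Hypothesis hphi : d_continuous phi.
Variable mu : probability (SigmaB R k) R.
Hypothesis mu_inv : shift_invariant mu.

Let S := SigmaB R k.

Lemma d_open_measurable (A : set S) : d_open R A -> measurable A.
Proof. by move=> oA; exact: sub_gen_smallest. Qed.

Let phi_meas : measurable_fun setT (phi : S -> R).
Proof.
move=> mD; apply: (measurability _ (RGenOInfty.measurableE R)) => //.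
move=> _ [_ [r ->] <-]; rewrite setTI; apply: d_open_measurable => x /=.
rewrite in_itv/= andbT => rx.
have [d d0 Hd] := hphi x (etrans (subr_gt0 _ _) rx).
exists d => // y yd; rewrite /= in_itv/= andbT.
have : `|phi y - phi x| < phi x - r.
  apply: Hd; suff -> : dist R x y = dist R y x by [].
  by rewrite /dist; congr (limn (series _)); apply/funext => n; rewrite eq_sym.
by rewrite ltr_norml => /andP[]; lra.
Qed.

Let shiftn_meas n : measurable_fun setT (shiftn n : S -> S).
Proof.
apply: (@measurability _ _ S S setT (shiftn n) (@d_open R k)) => //.
move=> _ [A oA <-]; rewrite setTI; apply: d_open_measurable => x /= /oA[e e0 He].
have [h hb] := ball_agree (shiftn n x) e0.
exists (2 ^- (n + h)%N); first by rewrite invr_gt0 exprn_gt0.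
move=> y /agree_dist xy; apply/He/hb; exact: agree_shiftn.
Qed.

Let phin_int n : mu.-integrable setT (EFin \o (phi \o shiftn n : S -> R)).
Proof.
apply: measurable_bounded_integrable => //.
- exact: le_lt_trans (probability_le1 mu measurableT) (ltry 1).
- exact: (@measurableT_comp _ _ _ S S (measurableTypeR R) phi _ (shiftn n)).
have [C [C0 HC]] := phi_bounded hphi.
exists C; split; first by rewrite num_real.
by move=> M CM x _ /=; exact: le_trans (HC _) (ltW CM).
Qed.

Let int_shift n : (\int[mu]_x ((phi \o shiftn n) x)%:E = \int[mu]_x (phi x)%:E)%E.
Proof.
elim: n => [|n IH]; first by [].
rewrite -[RHS]IH.
pose sh : S -> S := @Defs.shift k.
have shE (y : S) : shiftn n (sh y) = shiftn n.+1 y by exact: (shiftnD n 1 y).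
have msh : measurable_fun setT sh.
  by have := @shiftn_meas 1; rewrite (_ : shiftn 1 = sh)//; apply/funext.
transitivity (\int[mu]_(x in sh @^-1` setT) (((EFin \o (phi \o shiftn n)) \o sh) x))%E.
  by rewrite preimage_setT; apply: eq_integral => y _ /=; rewrite shE.
rewrite -integral_pushforward//=.
- by apply: eq_measure_integral => A mA _; exact: mu_inv.
- by have /integrableP[] := phin_int n.
have := phin_int n.+1; by apply: eq_integrable => // y _ /=; rewrite shE.
Qed.

Lemma integral_BS : exists2 r : R, (\int[mu]_x (phi x)%:E = r%:E)%E &
  forall n, mu.-integrable setT (EFin \o (fun x : S => birk_sum phi x n)) /\
   (\int[mu]_x (birk_sum phi x n)%:E = (n%:R * r)%:E)%E.
Proof.
exists (fine (\int[mu]_x (phi x)%:E)%E).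
  by rewrite fineK//; exact: (integrable_fin_num measurableT (phin_int 0)).
set r := fine _.
have Er : (\int[mu]_x (phi x)%:E = r%:E)%E.
  by rewrite /r fineK//; exact: (integrable_fin_num measurableT (phin_int 0)).
elim=> [|n [IH1 IH2]].
  have -> : (fun x : S => birk_sum phi x 0) = cst 0 by apply/funext => x; rewrite BS0.
  split; first exact: finite_measure_integrable_cst.
  under eq_integral do rewrite BS0.
  by rewrite integral0 mul0r.
have -> : EFin \o (fun x : S => birk_sum phi x n.+1) =
    ((EFin \o (fun x : S => birk_sum phi x n)) \+ (EFin \o (phi \o shiftn n)))%E.
  by apply/funext => x /=; rewrite BSS EFinD.
split; first exact: integrableD.
under eq_integral do rewrite BSS.
have := integralD_EFin measurableT IH1 (phin_int n) => /= ->.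
rewrite IH2 (int_shift n) Er -EFinD; congr (_%:E).
by rewrite -[n.+1%:R]natr1 mulrDl mul1r.
Qed.

(** Otherwise the integral of the sum, which by invariance is [n] times that of [phi], would be at
    least [n%:R * r]. *)
Lemma BS_le_integral (r : R) : (\int[mu]_x (phi x)%:E < r%:E)%E ->
  forall n, exists x, birk_sum phi x n <= n%:R * r.
Proof.
have [r' -> H] := integral_BS; rewrite lte_fin => r'r [|n].
  by exists (fun=> ord0); rewrite BS0 mul0r.
apply: contrapT => /forallNP Hx.
have [I1 I2] := H n.+1.
have I3 := finite_measure_integrable_cst mu (n.+1%:R * r) (@measurableT _ S).
have := le_integral measurableT I3 I1 _.
rewrite [X in (_ <= X)%E]I2 /= integral_cst//= probability_setT mule1 lee_fin.
rewrite ler_pM2l ?ltr0n// leNgt r'r => /(_ _)/negP; apply => // x _ /=.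
by rewrite lee_fin ltW// ltNge; apply/negP; exact: Hx.
Qed.

Lemma BS_ge_integral (r : R) : (r%:E < \int[mu]_x (phi x)%:E)%E ->
  forall n, exists x, n%:R * r <= birk_sum phi x n.
Proof.
have [r' -> H] := integral_BS; rewrite lte_fin => r'r [|n].
  by exists (fun=> ord0); rewrite BS0 mul0r.
apply: contrapT => /forallNP Hx.
have [I1 I2] := H n.+1.
have I3 := finite_measure_integrable_cst mu (n.+1%:R * r) (@measurableT _ S).
have := le_integral measurableT I1 I3 _.
rewrite [X in (X <= _)%E]I2 /= integral_cst//= probability_setT mule1 lee_fin.
rewrite ler_pM2l ?ltr0n// leNgt r'r => /(_ _)/negP; apply => // x _ /=.
by rewrite lee_fin ltW// ltNge; apply/negP; exact: Hx.
Qed.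

End Invariant.

(** Measures whose integrals lie on either side of [a] yield the two bounds; midpoints keep the
    inequalities strict. The construction uses invariant measures only through this lemma. *)
Lemma in_IntL_BS (R : realType) (k : nat) (phi : Sigma k -> R) (a : R) :
  d_continuous phi -> in_IntL phi a ->
  exists al be, [/\ al < a, a < be,
    forall n, exists x, birk_sum phi x n <= n%:R * al &
    forall n, exists x, n%:R * be <= birk_sum phi x n].
Proof.
move=> hphi /andP[/ereal_inf_lt[_ [mu mui <-] mua] /ereal_sup_gt[_ [nu nui <-] nua]].
have [r Er _] := integral_BS hphi mui; have [s Es _] := integral_BS hphi nui.
move: (mua) (nua); rewrite Er Es !lte_fin => ra sa.
exists ((r + a) / 2), ((s + a) / 2); split; [lra|lra| |].
  by apply: BS_le_integral mui _ _ => //; rewrite Er lte_fin; lra.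
by apply: BS_ge_integral nui _ _ => //; rewrite Es lte_fin; lra.
Qed.

(** * Distortion of Birkhoff sums and mixtures of two words *)

Section Distortion.
Variables (R : realType) (k : nat) (phi : Sigma k -> R).
Hypothesis hphi : d_continuous phi.
Notation BS := (birk_sum phi).

Lemma BS_bound : exists C : R, 0 < C /\ forall x n, `|BS x n| <= C * n%:R.
Proof.
have [C [C0 HC]] := phi_bounded hphi; exists C; split => // x n.
rewrite /birk_sum; apply: le_trans (ler_norm_sum _ _ _) _.
apply: (@le_trans _ _ (\sum_(i < n) C)); first by apply: ler_sum => i _; exact: HC.
by rewrite sumr_const card_ord mulr_natr.
Qed.

(* Uniform continuity replaces bounded distortion: the error is sublinear. *)
Lemma BS_distortion (e : R) : 0 < e -> exists C : R, 0 < C /\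
  forall m x y, agree m x y -> `|BS x m - BS y m| <= e * m%:R + C.
Proof.
move=> e0; have [h Hh] := unif_cont hphi e0.
have [C0 [C00 HC]] := BS_bound.
exists (C0 * h%:R + C0 * h%:R + 1); split.
  by rewrite ltr_wpDl// addr_ge0// mulr_ge0// ltW.
have small n x y : agree n x y -> (n <= h)%N ->
    `|BS x n - BS y n| <= C0 * h%:R + C0 * h%:R.
  move=> _ nh; apply: le_trans (ler_normB _ _) _.
  by apply: lerD; apply: le_trans (HC _ _) _; rewrite ler_pM2l// ler_nat.
move=> m x y xy; have [mh|/ltnW hm] := leqP m h.
  have := small _ _ _ xy mh; have : 0 <= e * m%:R by rewrite mulr_ge0// ltW.
  lra.
(* The first [m - h] shifted pairs still agree on [h] letters, so each of these terms costs at most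
   [e]; the last [h] terms are bounded trivially. *)
move: xy; rewrite -(subnK hm); set n := (m - h)%N => xy.
rewrite !BSD; set a := shiftn n x; set b := shiftn n y.
have ab : `|BS a h - BS b h| <= C0 * h%:R + C0 * h%:R.
  by apply: small => //; exact: agree_shiftn.
have H : `|BS x n - BS y n| <= e * n%:R.
  rewrite /birk_sum -sumrB; apply: le_trans (ler_norm_sum _ _ _) _.
  apply: (@le_trans _ _ (\sum_(i < n) e)).
    apply: ler_sum => i _; apply/ltW/Hh/agree_shiftn; apply: agreeS xy.
    by rewrite leq_add2r ltnW.
  by rewrite sumr_const card_ord mulr_natr.
have -> : BS x n + BS a h - (BS y n + BS b h) = (BS x n - BS y n) + (BS a h - BS b h).
  by ring.
apply: le_trans (ler_normD _ _) _.
rewrite natrD mulrDr; have : 0 <= e * h%:R by rewrite mulr_ge0// ltW.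
lra.
Qed.

Lemma BS_blocks_le (L M : nat) (c : R) y :
  (forall q, (q < M)%N -> BS (shiftn (q * L) y) L <= c * L%:R) ->
  BS y (M * L) <= c * (M * L)%:R.
Proof.
elim: M => [|M IH] H; first by rewrite mul0n BS0 mulr0.
rewrite mulSnr BSD natrD mulrDr lerD ?H// IH// => q qM.
by rewrite H// ltnW.
Qed.

Lemma BS_blocks_ge (L M : nat) (c : R) y :
  (forall q, (q < M)%N -> c * L%:R <= BS (shiftn (q * L) y) L) ->
  c * (M * L)%:R <= BS y (M * L).
Proof.
elim: M => [|M IH] H; first by rewrite mul0n BS0 mulr0.
rewrite mulSnr BSD natrD mulrDr lerD ?H// IH// => q qM.
by rewrite H// ltnW.
Qed.

Definition periodic (L : nat) (x : Sigma k) : Sigma k := fun i => x (i %% L)%N.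

Lemma periodic_agree L x : agree L x (periodic L x).
Proof. by move=> i iL; rewrite /periodic modn_small. Qed.

Lemma periodic_shift L x q : shiftn (q * L) (periodic L x) = periodic L x.
Proof. by apply/funext => i; rewrite /shiftn /periodic modnMDl. Qed.

Lemma agree_periodic_block L x P y q : (q < P)%N -> agree (P * L) (periodic L x) y ->
  agree L x (shiftn (q * L) y).
Proof.
move=> qP H; apply: agree_trans (@periodic_agree L x) _.
rewrite -(periodic_shift L x q); apply: agree_shiftn.
by apply: agreeS H; rewrite addnC -mulSn leq_mul2r qP orbT.
Qed.

(** A finite word of extreme average is repeated periodically. Per block the distortion costs
    [d / 4 * n%:R + C], which is at most [d / 2 * n%:R] for the chosen [n]; the two bounds thus move
    by [d / 2] and stay on their sides of [a]. *)
Lemma low_high_words a : in_IntL phi a -> exists al be (U V : Sigma k) (L : nat),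
  [/\ al < a, a < be, (0 < L)%N,
    forall P y, agree (P * L) U y -> BS y (P * L) <= al * (P * L)%:R &
    forall P y, agree (P * L) V y -> be * (P * L)%:R <= BS y (P * L)].
Proof.
move=> /(in_IntL_BS hphi)[al [be [ala abe Hal Hbe]]].
pose d := Num.min (a - al) (be - a).
have d0 : 0 < d by rewrite lt_min !subr_gt0 ala abe.
have dal : d <= a - al by rewrite ge_min lexx.
have dbe : d <= be - a by rewrite ge_min lexx orbT.
have [C [C0 HC]] := BS_distortion (divr_gt0 d0 (ltr0Sn R 3)).
pose n := (Num.truncn (C / (d / 4))).+1.
have nC : C <= d / 4 * n%:R.
  by rewrite -ler_pdivrMl ?divr_gt0// mulrC ltW// truncnS_gt.
have [x Hx] := Hal n; have [y Hy] := Hbe n.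
have n0 : 0 < n%:R :> R by rewrite ltr0n.
exists (al + d / 2), (be - d / 2), (periodic n x), (periodic n y), n.
split => //; [lra|lra| |] => P w Hw.
  apply: BS_blocks_le => q qP; have := HC _ _ _ (agree_periodic_block qP Hw).
  by rewrite ler_norml => /andP[]; nra.
apply: BS_blocks_ge => q qP; have := HC _ _ _ (agree_periodic_block qP Hw).
by rewrite ler_norml => /andP[]; nra.
Qed.

Definition mix (L : nat) (A B : Sigma k) (p : nat) : Sigma k :=
  fun i => (if (i < p * L)%N then A else B) (i %% L)%N.

Lemma mix_block L A B p q :
  agree L (shiftn (q * L) (mix L A B p)) (if (q < p)%N then A else B).
Proof.
move=> i iL; rewrite /shiftn /mix modnMDl modn_small//.
congr ((if _ then _ else _) _); apply/idP/idP => [H|qp].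
  rewrite -(ltn_pmul2r (leq_ltn_trans (leq0n i) iL)).
  exact: leq_ltn_trans (leq_addr _ _) H.
apply: (@leq_trans (q * L + L)%N); first by rewrite ltn_add2l.
by rewrite -mulSnr leq_mul2r qp orbT.
Qed.

(* Discrete intermediate value theorem in the number [p] of blocks [A].    *)
Lemma mix_average (L : nat) (A B : Sigma k) (c c' b d : R) :
  (0 < L)%N -> 0 < d -> c < b -> b < c' ->
  (forall y, agree L A y -> BS y L <= c * L%:R) ->
  (forall y, agree L B y -> c' * L%:R <= BS y L) ->
  exists M0 : nat, forall M, (M0 <= M)%N -> (0 < M)%N -> exists p, [/\ (0 < p)%N, (p <= M)%N &
    forall y, agree (M * L) (mix L A B p) y ->
      `|BS y (M * L) - b * (M * L)%:R| <= d * (M * L)%:R].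
Proof.
move=> L0 d0 cb bc HA HB.
have [C [C0 HC]] := BS_distortion (divr_gt0 d0 (ltr0Sn R 3)).
have [C1 [C10 HC1]] := BS_bound.
(* One [C] pays for comparing [y] with the mixture, the other together with [2 * C1 * L%:R] for a
   unit step of [p]. *)
pose D := 2 * C + 2 * C1 * L%:R.
exists (Num.truncn (D / (d / 2))).+1 => M MM M0.
have DM : D <= d / 2 * (M * L)%:R.
  apply: (@le_trans _ _ (d / 2 * M%:R)).
    rewrite -ler_pdivrMl ?divr_gt0// mulrC; apply: le_trans (ltW (truncnS_gt _)) _.
    by rewrite ler_nat.
  by rewrite ler_pM2l ?divr_gt0// ler_nat leq_pmulr.
have T0 : 0 < (M * L)%:R :> R by rewrite ltr0n muln_gt0 M0 L0.
pose G p := BS (mix L A B p) (M * L).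
have [|p Hp pmin] := @ex_minnP (fun p => G p <= b * (M * L)%:R).
  exists M; apply: (@le_trans _ _ (c * (M * L)%:R)); last by rewrite ler_pM2r// ltW.
  apply: BS_blocks_le => q qM; apply: HA; apply: agree_sym.
  by have := @mix_block L A B M q; rewrite qM.
have p0 : (0 < p)%N.
  rewrite lt0n; apply/eqP => p0; move: Hp; rewrite leNgt => /negP; apply.
  apply: (@lt_le_trans _ _ (c' * (M * L)%:R)); first by rewrite ltr_pM2r.
  apply: BS_blocks_ge => q qM; apply: HB; apply: agree_sym.
  by have := @mix_block L A B p q; rewrite p0 ltn0.
have pM : (p <= M)%N.
  apply: pmin; apply: (@le_trans _ _ (c * (M * L)%:R)); last by rewrite ler_pM2r// ltW.
  apply: BS_blocks_le => q qM; apply: HA; apply: agree_sym.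
  by have := @mix_block L A B M q; rewrite qM.
exists p; split => // y Hy.
have Hp1 : b * (M * L)%:R < G p.-1.
  by rewrite ltNge; apply/negP => /pmin; rewrite leqNgt ltn_predL p0.
(* The two mixtures share the first [p.-1] blocks, whose sums differ by distortion only, and
   everything from [p * L] on; the block in between costs [2 * C1 * L%:R]. *)
have step : G p.-1 - G p <= d / 4 * (M * L)%:R + C + 2 * C1 * L%:R.
  rewrite /G; have -> : (M * L = p.-1 * L + (L + (M - p) * L))%N.
    by rewrite addnA -mulSnr prednK// -mulnDl subnKC.
  rewrite !BSD !shiftnD -mulSnr prednK//.
  have -> : shiftn (p * L) (mix L A B p.-1) = shiftn (p * L) (mix L A B p).
    apply/funext => i; rewrite /shiftn /mix.
    rewrite !ltnNge (leq_trans _ (leq_addr _ _)) ?leq_mul2r ?leq_pred ?orbT//.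
    by rewrite leq_addr.
  have Ha : agree (p.-1 * L) (mix L A B p.-1) (mix L A B p).
    move=> i ii; rewrite /mix ii (leq_trans ii)//.
    by rewrite leq_mul2r leq_pred orbT.
  have := HC _ _ _ Ha; rewrite ler_norml => /andP[_].
  have := HC1 (shiftn (p.-1 * L) (mix L A B p.-1)) L; rewrite ler_norml => /andP[_].
  have := HC1 (shiftn (p.-1 * L) (mix L A B p)) L; rewrite ler_norml => /andP[+ _].
  have : d / 4 * (p.-1 * L)%:R <= d / 4 * (p.-1 * L + (L + (M - p) * L))%:R.
    by rewrite ler_pM2l ?divr_gt0// ler_nat leq_addr.
  move: (BS _ _) (BS _ _) (BS _ _) (BS _ _) (BS _ _) => t1 t2 t3 t4 t5.
  lra.
have := HC _ _ _ Hy; rewrite -/(G p) !ler_norml => /andP[h1 h2].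
by move: DM; rewrite /D => DM; apply/andP; split; lra.
Qed.
End Distortion.
(** * Uniformly recurrent sequences with prescribed average *)

(** A pair of words of common length [len]; they are stored as points of which only the first [len]
    letters matter. *)
Record level (k : nat) := Level { len : nat; wlow : Sigma k; whigh : Sigma k }.

Section Minimal.
Variables (R : realType) (k : nat) (phi : Sigma k -> R).
Hypothesis hphi : d_continuous phi.
Notation BS := (birk_sum phi).
Variables (b e : R).
Hypothesis e0 : 0 < e.

Let eps (n : nat) : R := e / 4 ^+ n.

Let eps_gt0 n : 0 < eps n.
Proof. by rewrite divr_gt0// exprn_gt0. Qed.

Let epsS n : eps n = 4 * eps n.+1.
Proof. by rewrite /eps exprS invfM mulrCA mulVKf// mulrC. Qed.

Let inv n (s : level k) := [/\ (0 < len s)%N,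
  forall y, agree (len s) (wlow s) y -> BS y (len s) <= (b - eps n) * (len s)%:R &
  forall y, agree (len s) (whigh s) y -> (b + eps n) * (len s)%:R <= BS y (len s)].

Let next (s s' : level k) := exists M p p', [/\ (1 < M)%N, (0 < p)%N, (0 < p')%N,
  len s' = (M * len s)%N & (wlow s' = mix (len s) (wlow s) (whigh s) p /\
  whigh s' = mix (len s) (wlow s) (whigh s) p')].

Let tight n (s : level k) := forall y,
  agree (len s) (wlow s) y \/ agree (len s) (whigh s) y ->
  `|BS y (len s) - b * (len s)%:R| <= 3 * eps n * (len s)%:R.

(** The targets [b - 2 * eps n.+1] and [b + 2 * eps n.+1] lie in the range of level [n] because
    [eps n = 4 * eps n.+1]. Each is reached up to [eps n.+1], which leaves a margin [eps n.+1] and a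
    deviation of at most [3 * eps n.+1] from [b]. *)
Let next_level n s : inv n s -> exists s', [/\ inv n.+1 s', next s s' & tight n.+1 s'].
Proof.
move=> [L0 Hl Hh]; set L := len s in L0 Hl Hh *.
have e1 := eps_gt0 n.+1; have e2 := epsS n.
have i1 : b - eps n < b - 2 * eps n.+1 by lra.
have i2 : b - 2 * eps n.+1 < b + eps n by lra.
have i3 : b - eps n < b + 2 * eps n.+1 by lra.
have i4 : b + 2 * eps n.+1 < b + eps n by lra.
have [M1 HM1] := mix_average hphi L0 e1 i1 i2 Hl Hh.
have [M2 HM2] := mix_average hphi L0 e1 i3 i4 Hl Hh.
pose M := (M1 + M2 + 2)%N.
have [|//|p [p0 _ Hp]] := HM1 M; first by rewrite /M -addnA leq_addr.
  by rewrite /M addn2.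
have [||p' [p'0 _ Hp']] := HM2 M; first by rewrite /M addnAC leq_addl.
  by rewrite /M addn2.
have T0 : 0 < (M * L)%:R :> R by rewrite ltr0n muln_gt0 L0 /M addn2.
exists (Level (M * L) (mix L (wlow s) (whigh s) p) (mix L (wlow s) (whigh s) p')).
split.
- split => /=; first by rewrite muln_gt0 L0 /M addn2.
    by move=> y /Hp; rewrite ler_norml => /andP[_]; nra.
  by move=> y /Hp'; rewrite ler_norml => /andP[+ _]; nra.
- by exists M, p, p'; split => //; rewrite /M addn2.
- by move=> y /= [/Hp|/Hp']; rewrite !ler_norml => /andP[? ?]; apply/andP; split; nra.
Qed.

Variable s0 : level k.
Hypothesis inv0 : inv 0 s0.

Let next_ex n s : {s' | inv n s -> [/\ inv n.+1 s', next s s' & tight n.+1 s']}.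
Proof.
apply/cid; have [/next_level[s' ?]|?] := pselect (inv n s); first by exists s'.
by exists s.
Qed.

Let lev := fix lev n := if n is m.+1 then sval (next_ex m (lev m)) else s0.
Let L n := len (lev n).
Let A n := wlow (lev n).
Let B n := whigh (lev n).

Let invn n : inv n (lev n).
Proof. by elim: n => [//|n IH] /=; case: (svalP (next_ex n (lev n)) IH). Qed.

Let nextn n : next (lev n) (lev n.+1).
Proof. by rewrite /=; case: (svalP (next_ex n (lev n)) (invn n)). Qed.

Let tightn n : tight n.+1 (lev n.+1).
Proof. by rewrite /=; case: (svalP (next_ex n (lev n)) (invn n)). Qed.

Let L_gt0 n : (0 < L n)%N. Proof. by case: (invn n). Qed.

Let L_ge n : (n < L n)%N.
Proof.
elim: n => [|n IH]; first exact: L_gt0.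
have [M [p [p' [M1 _ _]]]] := nextn n; rewrite -!/(L _) => -> _.
apply: leq_ltn_trans IH _; rewrite -{1}[L n]mul1n ltn_pmul2r//.
Qed.

(** Since [p] and [p'] are positive, both words of level [n.+1] begin with the low word of level
    [n]; uniform recurrence rests on this. *)
Let A_next n : agree (L n) (A n) (A n.+1) /\ agree (L n) (A n) (B n.+1).
Proof.
have [M [p [p' [_ p0 p'0 _ [EA EB]]]]] := nextn n.
rewrite /A /B EA EB; split; apply: agree_sym.
  by have := @mix_block k (L n) (A n) (B n) p 0; rewrite p0.
by have := @mix_block k (L n) (A n) (B n) p' 0; rewrite p'0.
Qed.

Let L_mono n m : (n <= m)%N -> (L n <= L m)%N.
Proof.
move=> /subnK<-; elim: (m - n)%N => // d IH; rewrite addSn.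
apply: leq_trans IH _; have [M [p [p' [M1 _ _]]]] := nextn (d + n)%N.
by rewrite -!/(L _) => -> _; rewrite leq_pmull// ltnW.
Qed.

Let A_mono n m : (n <= m)%N -> agree (L n) (A n) (A m).
Proof.
move=> /subnK<-; elim: (m - n)%N => // d IH; rewrite addSn.
apply: agree_trans IH _; apply: agreeS (A_next _).1.
by apply: L_mono; exact: leq_addl.
Qed.

(** The low words are nested prefixes, and by [L_ge] position [i] falls inside the word [A i], so
    the diagonal is their limit. *)
Let z : Sigma k := fun i => A i i.

Let z_A n : agree (L n) (A n) z.
Proof.
move=> i iL; rewrite /z; have [ni|/ltnW ni] := leqP n i; first exact: A_mono.
by rewrite (A_mono ni)// L_ge.
Qed.

Let blocky n (x : Sigma k) m := forall q, (q.+1 * L n <= m)%N ->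
  agree (L n) (A n) (shiftn (q * L n) x) \/ agree (L n) (B n) (shiftn (q * L n) x).

(** With [L N = K * L n], block [q] of level [n] is block [q %% K] inside block [q %/ K] of level
    [N]. *)
Let blocky_mix n N p m : (L n %| L N)%N -> blocky n (A N) (L N) ->
  blocky n (B N) (L N) -> blocky n (mix (L N) (A N) (B N) p) m.
Proof.
move=> /dvdnP[K EK] HA HB q _; set x := mix _ _ _ _.
have K0 : (0 < K)%N by have := L_gt0 N; rewrite EK muln_gt0 => /andP[].
have H := @mix_block k (L N) (A N) (B N) p (q %/ K); rewrite -/x in H.
have Eq : (q * L n = q %/ K * L N + q %% K * L n)%N.
  by rewrite EK mulnA -mulnDl -divn_eq.
have qK : ((q %% K).+1 * L n <= L N)%N by rewrite EK leq_mul2r ltn_pmod// orbT.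
have G w : agree (L N) (shiftn (q %/ K * L N) x) w ->
   agree (L n) (shiftn (q %% K * L n) w) (shiftn (q * L n) x).
  move=> Hw; rewrite Eq -shiftnD; apply/agree_sym/agree_shiftn.
  by apply: agreeS Hw; rewrite addnC -mulSn.
have : blocky n (if (q %/ K < p)%N then A N else B N) (L N) by case: ifP.
by move=> /(_ _ qK)[] h; [left|right]; apply: agree_trans h (G _ H).
Qed.

Let blocky_top n d : [/\ (L n %| L (d + n))%N, blocky n (A (d + n)%N) (L (d + n)%N) &
  blocky n (B (d + n)%N) (L (d + n)%N)].
Proof.
elim: d => [|d [dvd HA HB]].
  rewrite add0n; split => // q; rewrite -[leqRHS]mul1n leq_pmul2r// ltnS leqn0.
    by move=> /eqP->; left.
  by move=> /eqP->; right.
have [M [p [p' [M1 p0 p'0 EL [EA EB]]]]] := nextn (d + n)%N.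
rewrite addSn; rewrite -!/(L _) in EL.
split; first by rewrite EL dvdn_mull.
  by rewrite {1}/A EA; exact: blocky_mix.
by rewrite {1}/B EB; exact: blocky_mix.
Qed.

Let z_blocky n q : agree (L n) (A n) (shiftn (q * L n) z) \/
  agree (L n) (B n) (shiftn (q * L n) z).
Proof.
have [_ H _] := blocky_top n (q.+1 * L n)%N.
have qL : (q.+1 * L n <= L (q.+1 * L n + n))%N.
  by apply: leq_trans (ltnW (L_ge _)); exact: leq_addr.
have zA : agree (L n) (shiftn (q * L n) (A (q.+1 * L n + n)%N)) (shiftn (q * L n) z).
  apply: agree_shiftn; apply: agreeS (@z_A (q.+1 * L n + n)%N).
  by apply: leq_trans qL; rewrite mulSn addnC.
by have [h|h] := H _ qL; [left|right]; exact: agree_trans zA.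
Qed.

Lemma minimal_seq : exists z : Sigma k, [/\ agree (len s0) (wlow s0) z,
  forall h, exists K, forall m, exists i, (i < K)%N /\ agree h z (shiftn (m + i) z) &
  forall d : R, 0 < d -> exists N, forall n, (N <= n)%N -> forall m,
    `|BS (shiftn m z) n - b * n%:R| <= d * n%:R].
Proof.
exists z; split; first exact (@z_A 0%N).
  (* Both words of level [h.+1] begin with [A h], so the prefix is seen at the first block boundary
     after [m]. *)
  move=> h; exists (L h.+1).+1 => m.
  pose q := (m %/ L h.+1).+1.
  have mq : (m <= q * L h.+1)%N by rewrite ltnW// ltn_ceil.
  exists (q * L h.+1 - m)%N; split.
    rewrite ltnS leq_subLR /q mulSn addnC leq_add2r -[leqRHS]addn0.
    by rewrite addn0 leq_trunc_div.
  rewrite subnKC//; apply: (@agree_trans _ _ _ (A h)).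
    by apply: agree_sym; apply: agreeS (@z_A h); rewrite ltnW.
  have hL : (h <= L h)%N by rewrite ltnW.
  have hL1 : (L h <= L h.+1)%N by rewrite L_mono.
  have [/(agreeS hL1) H|/(agreeS hL1) H] := z_blocky h.+1 q; apply: (agreeS hL).
    exact: agree_trans (A_next h).1 H.
  exact: agree_trans (A_next h).2 H.
move=> d d0.
have [l Hl] : exists l, 3 * eps l.+1 < d / 2.
  have [h hh] := exists_pow_lt (divr_gt0 d0 (mulr_gt0 (ltr0Sn R 5) e0)).
  exists h; apply: (@le_lt_trans _ _ (3 * e * 2 ^- h)).
    rewrite /eps -mulrA ler_pM2l// ler_pM2l// lef_pV2 ?posrE ?exprn_gt0//.
    rewrite exprS; apply: (@le_trans _ _ (4 ^+ h)).
      by apply: lerXn2r; rewrite ?nnegrE//; lra.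
    have : 0 <= 4 ^+ h :> R by exact: exprn_ge0.
    move: (4 ^+ h) => w; lra.
  have e60 : 0 < 6 * e by rewrite mulr_gt0.
  by move: hh; rewrite ltr_pdivlMr// => hh; lra.
have [C [C0 HC]] := BS_bound hphi.
set LL := L l.+1; have LL0 : (0 < LL)%N by exact: L_gt0.
pose C1 := C + `|b|; have C10 : 0 < C1 by rewrite ltr_wpDr.
(* The deviation is additive along the orbit. Full blocks of level [l.+1] are controlled by [tight],
   with [3 * eps l.+1 < d / 2], and the two incomplete pieces at the ends cost at most [C1 * LL%:R]
   each. *)
pose dev x n := BS x n - b * n%:R.
have devD x m n : dev x (m + n)%N = dev x m + dev (shiftn m x) n.
  by rewrite /dev BSD natrD; ring.
have dev_le x n : `|dev x n| <= C1 * n%:R.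
  apply: le_trans (ler_normB _ _) _; rewrite mulrDl lerD// ?HC//.
  by rewrite normrM normr_nat.
have devB q c : `|dev (shiftn (q * LL) z) (c * LL)| <= 3 * eps l.+1 * (c * LL)%:R.
  elim: c q => [|c IH] q.
    by rewrite mul0n mulr0; apply: le_trans (dev_le _ _) _; rewrite mulr0.
  rewrite mulSn devD shiftnD -mulSnr natrD mulrDr.
  apply: le_trans (ler_normD _ _) _; rewrite lerD ?IH//.
  exact: tightn (z_blocky _ _).
exists (Num.truncn (4 * C1 * LL%:R / d)).+1 => n Nn m; rewrite -/(dev _ _).
have nC : 4 * C1 * LL%:R <= d * n%:R.
  rewrite -ler_pdivrMl// mulrC; apply: le_trans (ltW (truncnS_gt _)) _.
  by rewrite ler_nat.
have LL0' : 0 < LL%:R :> R by rewrite ltr0n.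
pose q := (m %/ LL).+1.
have mq : (m <= q * LL)%N by rewrite ltnW// ltn_ceil.
pose r := (q * LL - m)%N.
have rL : (r <= LL)%N.
  by rewrite leq_subLR /q mulSn addnC leq_add2r leq_trunc_div.
have [nr|rn] := ltnP n r.
  apply: le_trans (dev_le _ _) _.
  have nL : n%:R <= LL%:R :> R by rewrite ler_nat (leq_trans (ltnW nr)).
  apply: le_trans (_ : C1 * LL%:R <= _); first by rewrite ler_pM2l.
  apply: le_trans nC; have := mulr_gt0 C10 LL0'; lra.
have En : n = (r + ((n - r) %/ LL * LL + (n - r) %% LL))%N.
  by rewrite -divn_eq subnKC.
have Hc : ((n - r) %/ LL * LL <= n)%N.
  by apply: leq_trans (leq_trunc_div _ _) _; exact: leq_subr.
rewrite {1}En !devD !shiftnD subnKC//.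
apply: le_trans (ler_normD _ _) _; apply: le_trans (lerD (dev_le _ _) (ler_normD _ _)) _.
have h1 := devB q ((n - r) %/ LL)%N.
set t := ((n - r) %/ LL * LL)%N in Hc h1 *.
have h2 := dev_le (shiftn (q * LL + t) z) ((n - r) %% LL)%N.
have h3 : C1 * ((n - r) %% LL)%:R <= C1 * LL%:R by rewrite ler_pM2l// ler_nat ltnW// ltn_pmod.
have h4 : C1 * r%:R <= C1 * LL%:R by rewrite ler_pM2l// ler_nat.
have h5 : 3 * eps l.+1 * t%:R <= d / 2 * n%:R.
  by apply: ler_pM; rewrite ?ler_nat// ?ltW// mulr_gt0.
lra.
Qed.

End Minimal.
(** * Counting *)

Section Counting.
Local Open Scope nat_scope.
Implicit Types S T : pred nat.

Definition cnt S m n := \sum_(i < n) S (m + i).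

Lemma cnt0 S m : cnt S m 0 = 0. Proof. by rewrite /cnt big_ord0. Qed.

Lemma cntD S m n1 n2 : cnt S m (n1 + n2) = cnt S m n1 + cnt S (m + n1) n2.
Proof.
rewrite /cnt big_split_ord /=; congr (_ + _).
by apply: eq_bigr => i _; rewrite addnA.
Qed.

Lemma cnt1 S m : cnt S m 1 = S m.
Proof. by rewrite /cnt big_ord1 addn0. Qed.

Lemma cnt_le S m n : cnt S m n <= n.
Proof.
rewrite -[leqRHS](card_ord n) -sum1_card; apply: leq_sum => i _; exact: leq_b1.
Qed.

Lemma cnt_sub S T m n : (forall i, m <= i -> i < m + n -> S i -> T i) ->
  cnt S m n <= cnt T m n.
Proof.
move=> H; apply: leq_sum => i _.
have := H (m + i) (leq_addr _ _); rewrite ltn_add2l ltn_ord => /(_ isT).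
by case: (S _) => // ->.
Qed.

Lemma eq_cnt S T m n : (forall i, m <= i -> i < m + n -> S i = T i) ->
  cnt S m n = cnt T m n.
Proof. by move=> H; apply/eqP; rewrite eqn_leq !cnt_sub// => i h1 h2; rewrite H. Qed.

Lemma cntU S T m n : cnt (predU S T) m n <= cnt S m n + cnt T m n.
Proof.
by rewrite /cnt -big_split; apply: leq_sum => i _ /=; case: (S _); case: (T _).
Qed.

Lemma cntC S m n : cnt S m n + cnt (predC S) m n = n.
Proof.
rewrite /cnt -big_split /= -[RHS](card_ord n) -sum1_card; apply: eq_bigr => i _.
by case: (S _).
Qed.

Lemma cnt_pred0 S m n : (forall i, m <= i -> i < m + n -> ~~ S i) -> cnt S m n = 0.
Proof.
move=> H; apply/eqP; rewrite -leqn0 -[0](_ : cnt pred0 m n = 0).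
  by apply: cnt_sub => i h1 h2; rewrite (negbTE (H i h1 h2)).
by rewrite /cnt big1.
Qed.

Lemma cnt_predT S m n : (forall i, m <= i -> i < m + n -> S i) -> cnt S m n = n.
Proof.
move=> H; rewrite -[RHS](cntC S m n) [cnt (predC _) _ _]cnt_pred0 ?addn0// => i h1 h2.
by rewrite /= H.
Qed.

Lemma cnt_window S m n m' n' : m' <= m -> m + n <= m' + n' -> cnt S m n <= cnt S m' n'.
Proof.
move=> h1 h2; have -> : n' = (m - m') + (n + (m' + n' - (m + n))) by lia.
by rewrite !cntD subnKC// addnCA leq_addr.
Qed.

Lemma cnt_shift S h m n : cnt (fun i => S (i + h)) m n = cnt S (m + h) n.
Proof. by apply: eq_bigr => i _; rewrite addnAC. Qed.

Lemma cnt_blocks S m d e B : (forall q, q < e -> cnt S (m + q * d) d <= B) ->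
  cnt S m (e * d) <= e * B.
Proof.
elim: e => [|e IH] H; first by rewrite !mul0n cnt0.
by rewrite !mulSnr cntD leq_add ?H// IH// => q qe; rewrite H// ltnW.
Qed.

Lemma cnt_blocks_eq S m d e B : (forall q, q < e -> cnt S (m + q * d) d = B) ->
  cnt S m (e * d) = e * B.
Proof.
elim: e => [|e IH] H; first by rewrite !mul0n cnt0.
by rewrite !mulSnr cntD H// IH// => q qe; rewrite H// ltnW.
Qed.

Lemma cnt_ltn b m n : cnt (fun i => i < b) m n <= b - m.
Proof.
have [nb|bn] := leqP n (b - m); first exact: leq_trans (cnt_le _ _ _) nb.
rewrite -(subnKC (ltnW bn)) cntD [X in _ + X]cnt_pred0 ?addn0 ?cnt_le// => i h1 _.
by rewrite -leqNgt; lia.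
Qed.

Lemma cnt_dvdn d m e : 0 < d -> d %| m -> cnt (dvdn d) m (e * d) = e.
Proof.
case: d => // d _ dm; rewrite (@cnt_blocks_eq _ _ _ _ 1) ?muln1// => q _.
have dq : d.+1 %| m + q * d.+1 by rewrite dvdn_add// dvdn_mull.
rewrite -[in X in cnt _ _ X]add1n cntD cnt1 dq cnt_pred0// => i h1 h2.
have -> : i = (m + q * d.+1) + (i - (m + q * d.+1)) by lia.
by rewrite dvdn_addr//; apply/negP => /dvdn_leq; lia.
Qed.

(** Zero upper Banach density and, below, zero density, both without division: [1 / K] plays the
    part of epsilon. *)
Definition zero_banach S := forall K, exists n0, forall n m, n0 <= n -> K * cnt S m n <= n.
Definition zero_dens S := forall K, exists n0, forall n, n0 <= n -> K * cnt S 0 n <= n.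

Definition nearby S h := fun n => [exists i : 'I_h, S (n + i)].

Lemma nearby_cnt S h m n B : (forall m, cnt S m n <= B) -> cnt (nearby S h) m n <= h * B.
Proof.
move=> H; elim: h => [|h IH].
  by rewrite cnt_pred0// => i _ _; apply/existsPn => -[].
apply: (@leq_trans (cnt (predU (nearby S h) (fun i => S (i + h))) m n)).
  apply: cnt_sub => i _ _ /existsP[j Sj] /=; have := ltn_ord j.
  rewrite ltnS leq_eqVlt => /predU1P[<-|jh]; first by apply/orP; right.
  by apply/orP; left; apply/existsP; exists (Ordinal jh).
apply: leq_trans (cntU _ _ _ _) _; rewrite mulSnr leq_add//.
by rewrite cnt_shift.
Qed.

(** [nearby S h] is a union of [h] translates of [S], and each translated window sticks out of the
    original one by at most [h]. *)
Lemma nearby_cnt_le S h m n : cnt (nearby S h) m n <= h * (cnt S m n + h).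
Proof.
suff H h' : h' <= h -> cnt (nearby S h') m n <= h' * (cnt S m n + h) by exact: H.
elim: h' => [|h' IH] hh.
  by rewrite cnt_pred0// => i _ _; apply/existsPn => -[].
apply: (@leq_trans (cnt (predU (nearby S h') (fun i => S (i + h'))) m n)).
  apply: cnt_sub => i _ _ /existsP[j Sj] /=; have := ltn_ord j.
  rewrite ltnS leq_eqVlt => /predU1P[<-|jh]; first by apply/orP; right.
  by apply/orP; left; apply/existsP; exists (Ordinal jh).
apply: leq_trans (cntU _ _ _ _) _; rewrite mulSnr leq_add ?(IH (ltnW hh))//.
rewrite cnt_shift; apply: leq_trans (_ : cnt S m (n + h') <= _).
  by apply: cnt_window; lia.
by rewrite cntD leq_add2l (leq_trans (cnt_le _ _ _))// ltnW.
Qed.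

Lemma zero_banach_nearby S h : zero_banach S -> zero_banach (nearby S h).
Proof.
move=> zS K; have [n0 H] := zS (K * h.+1); exists n0 => n m nn.
have := @nearby_cnt S h.+1 m n (n %/ (K * h.+1)).
case: K H => [|K] H; first by [].
move=> /(_ _)/wrap[]; first by move=> m'; rewrite leq_divRL ?muln_gt0// mulnC H.
move=> h1; apply: (@leq_trans (K.+1 * cnt (nearby S h.+1) m n)).
  rewrite leq_mul2l /= cnt_sub// => i _ _ /existsP[j Sj]; apply/existsP.
  by exists (widen_ord (leqnSn h) j).
apply: (@leq_trans (K.+1 * (h.+1 * (n %/ (K.+1 * h.+1))))); first by rewrite leq_mul2l h1 orbT.
by rewrite mulnA mulnC leq_trunc_div.
Qed.

End Counting.
(** * Stages, copies and glitches *)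

Section Stages.
Local Open Scope nat_scope.
Variable c : nat.
Hypothesis c2 : 2 <= c.

(** The square in the exponent makes the ratio of consecutive stages at least [32 * 4 ^ j], while
    each stage start divides the next; [c] makes [stg 0] as large as required. *)
Definition stg j := 2 ^ ((j + c) ^ 2).

Lemma stg_gt0 j : 0 < stg j. Proof. by rewrite expn_gt0. Qed.

Lemma stgS j : stg j.+1 = stg j * 2 ^ (2 * (j + c)).+1.
Proof.
rewrite /stg -expnD; congr (2 ^ _); rewrite addSn -addn1 sqrnD; lia.
Qed.

Lemma stgS_ge j : stg j * 32 * 2 ^ j * 2 ^ j <= stg j.+1.
Proof.
rewrite stgS -!mulnA leq_pmul2l ?stg_gt0// (_ : 32 = 2 ^ 5)// -!expnD leq_exp2l//.
by have := c2; lia.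
Qed.

Lemma pow2_ge1 j : 0 < 2 ^ j. Proof. by rewrite expn_gt0. Qed.

Lemma stgS_big j : 32 * stg j <= stg j.+1.
Proof.
apply: leq_trans (stgS_ge j); rewrite mulnC -mulnA leq_pmulr//.
by rewrite muln_gt0 !pow2_ge1.
Qed.

Lemma stgS_big2 j : 32 * 2 ^ j * stg j <= stg j.+1.
Proof.
apply: leq_trans (stgS_ge j).
by rewrite (_ : 32 * 2 ^ j * stg j = stg j * 32 * 2 ^ j) ?leq_pmulr ?pow2_ge1//; lia.
Qed.

Lemma stg_dvd i j : i <= j -> stg i %| stg j.
Proof. by move=> ij; rewrite dvdn_exp2l// leq_exp2r// leq_add2r. Qed.

Lemma leq_stg i j : i <= j -> stg i <= stg j.
Proof. by move=> ij; rewrite dvdn_leq ?stg_gt0 ?stg_dvd. Qed.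

Lemma pow2_dvd_stg j : 2 ^ j.+2 %| stg j.
Proof.
rewrite dvdn_exp2l//; have := c2; move: c => d d2.
by apply: (@leq_trans (j + d)); [lia|rewrite expnS expn1; nia].
Qed.

Lemma pow2_leq_stg j : 4 * 2 ^ j <= stg j.
Proof.
by have := dvdn_leq (stg_gt0 j) (pow2_dvd_stg j); rewrite !expnS mulnA.
Qed.

Lemma stage_exists n : exists j, n < stg j.+1.
Proof.
exists n; apply: (@leq_trans (2 ^ n)); first exact: ltn_expl.
by apply: leq_trans (leq_trans (leq_pmull _ _) (pow2_leq_stg n)) (leq_stg (leqnSn _)).
Qed.

(** Stage 0 also absorbs the times before [stg 0], so [stg (st n) <= n] holds only from [stg 0]
    on. *)
Definition st n := ex_minn (stage_exists n).

Lemma st_lt n : n < stg (st n).+1.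
Proof. by rewrite /st; case: ex_minnP. Qed.

Lemma st_le n j : n < stg j.+1 -> st n <= j.
Proof. by rewrite /st; case: ex_minnP => i _ H /H. Qed.

Lemma st_ge n : stg 0 <= n -> stg (st n) <= n.
Proof.
case E : (st n) => [//|j] _; rewrite leqNgt; apply/negP => /st_le.
by rewrite E ltnn.
Qed.

Lemma st_gt0_ge n : 0 < st n -> stg (st n) <= n.
Proof.
move=> s0; apply: st_ge; rewrite leqNgt; apply/negP => n0.
have : st n <= 0 by apply: st_le; apply: leq_trans n0 (leq_stg _).
by rewrite leqNgt s0.
Qed.

Lemma st_eq n j : stg j <= n -> n < stg j.+1 -> st n = j.
Proof.
move=> h1 h2; apply/eqP; rewrite eqn_leq st_le//= leqNgt; apply/negP => h3.
have := leq_stg h3; rewrite leqNgt (leq_ltn_trans h1)//; exact: st_lt.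
Qed.

Lemma st_geq n j : stg j <= n -> j <= st n.
Proof.
move=> h; rewrite leqNgt; apply/negP => h3.
have := leq_stg h3; rewrite leqNgt (leq_ltn_trans h)//; exact: st_lt.
Qed.

(* Recurrence is forced by a copy of [0, stg (j-1)) placed at [stg j];      *)
(* [red] undoes all copyings, so that everything is a function of [red n]. *)
Definition copied n := (0 < st n) && (n < stg (st n) + stg (st n).-1).

Lemma copiedE n : copied n = (0 < st n) && (n < stg (st n) + stg (st n).-1).
Proof. by []. Qed.

Fixpoint redf f n :=
  if f is f'.+1 then if copied n then redf f' (n - stg (st n)) else n else n.
Definition red n := redf n.+1 n.

Lemma redf_stable f n : n < f -> redf f n = red n.
Proof.
rewrite /red; have [m] := ubnP n.
elim: m f n => // m IH [//|f] n nm nf; rewrite [LHS]/= [RHS]/=.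
case: ifP => // /andP[s0 _].
have := st_gt0_ge s0; have := stg_gt0 (st n) => h1 h2.
have h3 : n - stg (st n) < n by lia.
by rewrite !IH//; lia.
Qed.

Lemma redE n : red n = if copied n then red (n - stg (st n)) else n.
Proof.
rewrite {1}/red /=; case: ifP => // /andP[s0 _]; rewrite redf_stable//.
have := st_gt0_ge s0; have := stg_gt0 (st n); lia.
Qed.

Lemma red_copied n : copied n -> red n = red (n - stg (st n)).
Proof. by move=> h; rewrite redE h. Qed.

Lemma red_id n : ~~ copied n -> red n = n.
Proof. by move=> h; rewrite redE (negbTE h). Qed.

Lemma red_leq n : red n <= n.
Proof.
elim/ltn_ind: n => n IH; have [cn|/red_id->//] := boolP (copied n).
rewrite red_copied//; have /andP[s0 _] := cn.
have := st_gt0_ge s0; have := stg_gt0 (st n) => h1 h2.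
by apply: leq_trans (IH _ _) _; lia.
Qed.

(** Inside stage [j] the start, the end of the copy and all changes of type are multiples of
    [2 ^ j], so the cuts contain every place where the construction breaks. *)
Definition cut r := (r < stg 0) || (2 ^ st r %| r).
Definition glitch n := cut (red n).

Lemma glitchE n : glitch n = (red n < stg 0) || (2 ^ st (red n) %| red n).
Proof. by []. Qed.

Lemma ncut_st r : ~~ cut r.+1 -> stg 0 < r.+1 /\ st r.+1 = st r.
Proof.
rewrite negb_or -leqNgt => /andP[h0 hd].
have h1 := st_ge h0; have h2 := st_lt r.+1.
have ne : r.+1 != stg (st r.+1).
  apply: contraNneq hd => e; rewrite {2}e; apply: dvdn_trans (pow2_dvd_stg _).
  by rewrite dvdn_exp2l// leqW.
have h3 : stg (st r.+1) <= r by move: h1; rewrite leq_eqVlt eq_sym (negbTE ne).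
split; last by symmetry; apply: st_eq => //; exact: ltnW.
rewrite ltnS; apply: leq_trans h3; exact: leq_stg.
Qed.

Lemma ncut_ncopied r : ~~ cut r.+1 -> ~~ copied r.+1 -> ~~ copied r.
Proof.
move=> nc; have [h0 es] := ncut_st nc; apply: contra => /andP[s0 h1].
rewrite /copied es s0 /= ltn_neqAle h1 andbT.
apply: contraNneq nc => e; apply/orP; right; rewrite es e dvdn_add//.
  by apply: dvdn_trans (pow2_dvd_stg _); rewrite dvdn_exp2l// leqW.
by case: (st r) s0 => // j _; apply: dvdn_trans (pow2_dvd_stg j); rewrite dvdn_exp2l.
Qed.

(** A copy starts where [red] is 0, which is a cut, and the time just after a copy is a cut as well;
    strictly inside, both times lose the same stage start and the induction applies. *)
Lemma red_succ n : ~~ glitch n.+1 -> red n.+1 = (red n).+1.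
Proof.
elim/ltn_ind: n => n IH; rewrite /glitch.
have [cn|ncn] := boolP (copied n.+1); last first.
  by rewrite red_id// => /ncut_ncopied/(_ ncn)/red_id->.
have /andP[s0 h] := cn; have h1 := st_gt0_ge s0; have h2 := stg_gt0 (st n.+1).
have [e|ne] := eqVneq n.+1 (stg (st n.+1)).
  rewrite red_copied// -e subnn /cut (_ : red 0 = 0) ?stg_gt0//.
  by apply/eqP; rewrite -leqn0 red_leq.
have h3 : stg (st n.+1) <= n by move: h1; rewrite leq_eqVlt eq_sym (negbTE ne).
have es : st n = st n.+1 by apply: st_eq => //; apply: ltnW; exact: st_lt.
have cn' : copied n by rewrite /copied es s0 ltnW.
rewrite red_copied// [red n]red_copied// es subSn// => ng.
by apply: IH => //; lia.
Qed.

Lemma red_run n h : (forall i, i < h -> ~~ glitch (n + i)) ->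
  forall i, i < h -> [/\ stg 0 <= red n, red (n + i) = red n + i & st (red n + i) = st (red n)].
Proof.
move=> H; elim=> [|i IH] ih.
  rewrite !addn0; split => //; have := H 0 ih; rewrite addn0 /glitch /cut negb_or -leqNgt.
  by case/andP.
have [h0 h1 h2] := IH (ltnW ih); have := H _ ih; rewrite addnS => ng.
have := red_succ ng; rewrite h1 => h3; split => //; rewrite !addnS//.
by rewrite -h2; apply: (ncut_st _).2; rewrite -h3.
Qed.

End Stages.

(** * Zero Banach density of the glitches *)

Section Glitches.
Local Open Scope nat_scope.
Variable c : nat.
Hypothesis c2 : 2 <= c.
Local Notation stg := (stg c).
Local Notation st := (st c2).
Local Notation copied := (copied c2).
Local Notation red := (red c2).
Local Notation glitch := (glitch c2).

Lemma dvdn_ltn_addn d a b : 0 < d -> d %| a -> d %| b -> a < b -> a + d <= b.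
Proof.
move=> d0 /dvdnP[p ->] /dvdnP[q ->]; rewrite ltn_pmul2r// => pq.
by rewrite -mulSnr leq_mul2r pq orbT.
Qed.

Lemma glitch_ncopied i j : ~~ copied i -> j <= st i -> stg 0 <= i -> glitch i ->
  2 ^ j %| i.
Proof.
move=> nc ji i0; rewrite glitchE red_id// ltnNge i0 /=.
by apply: dvdn_trans; rewrite dvdn_exp2l.
Qed.

(** A block inside a copy has the count of an earlier block, whence the induction. In any other
    block, past an initial stretch of length at most [2 * stg J], nothing is copied and glitches are
    multiples of [2 ^ J]. *)
Lemma glitch_block J q :
  cnt glitch (q * stg J.+1) (stg J.+1) <= 2 * stg J + stg J.+1 %/ 2 ^ J.
Proof.
have dJ : 2 ^ J %| stg J.+1.
  by apply: dvdn_trans (pow2_dvd_stg c2 _); rewrite dvdn_exp2l//; lia.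
have cntd q' : cnt (dvdn (2 ^ J)) (q' * stg J.+1) (stg J.+1) = stg J.+1 %/ 2 ^ J.
  by rewrite -{2}(divnK dJ) cnt_dvdn ?pow2_ge1// dvdn_mull.
have S0 := stg_gt0 c J.+1; have J0 := stg_gt0 c J; have SJ := stgS_big c2 J.
elim/ltn_ind: q => -[|q] IH.
  rewrite -(cntd 0) mul0n; apply: leq_trans (leq_add (_ : cnt (fun i => i < 2 * stg J) 0 (stg J.+1) <= _) (leqnn _)); last first.
    by apply: leq_trans (cnt_ltn _ _ _) _; rewrite subn0.
  apply: leq_trans (cntU _ _ _ _); apply: cnt_sub => i _ iS gi /=.
  have [//|iJ] := ltnP i (2 * stg J); apply/orP; right.
  have si : st i = J by apply: st_eq => //; lia.
  have h0 := leq_stg c (leq0n J); have h1 := leq_stg c (leq_pred J).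
  apply: glitch_ncopied gi; rewrite ?si//; last by lia.
  by rewrite copiedE si negb_and; apply/orP; right; rewrite -leqNgt; lia.
set n := q.+1 * stg J.+1; set j := st n.
have nS : stg J.+1 <= n by rewrite /n mulSn leq_addr.
have jJ : J.+1 <= j by apply: st_geq.
have jn : stg j <= n by apply: st_gt0_ge; apply: leq_trans jJ.
have Sn : stg J.+1 %| n by rewrite dvdn_mull.
have nj : n + stg J.+1 <= stg j.+1.
  by apply: dvdn_ltn_addn => //; [exact/stg_dvd/leqW|exact: st_lt].
have sti i : n <= i -> i < n + stg J.+1 -> st i = j.
  by move=> h1 h2; apply: st_eq; [exact: leq_trans h1|exact: leq_trans nj].
have [/andP[Jj nc]|h] := boolP ((J.+1 < j) && (n < stg j + stg j.-1)).
  have jJ' : J.+1 <= j.-1 by lia.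
  have nj' : n + stg J.+1 <= stg j + stg j.-1.
    by apply: dvdn_ltn_addn => //; rewrite dvdn_add// stg_dvd.
  have -> : cnt glitch n (stg J.+1) = cnt glitch (n - stg j) (stg J.+1).
    rewrite -{1}[n](subnK jn) -cnt_shift; apply: eq_cnt => i h1 h2.
    rewrite !glitchE [red (i + _)]red_copied.
      by rewrite (sti (i + stg j)) ?addnK//; lia.
    by rewrite copiedE sti; [apply/andP; split; lia|lia|lia].
  have /dvdnP[p Ep] : stg J.+1 %| n - stg j by rewrite dvdn_sub// stg_dvd// ltnW.
  rewrite Ep; apply: IH; rewrite -(ltn_pmul2r S0) -Ep -/n.
  by have := stg_gt0 c j; lia.
rewrite -(cntd q.+1) -/n; apply: leq_trans (leq_add (_ : cnt (fun i => i < n + stg J) n (stg J.+1) <= _) (leqnn _)); last first.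
  by apply: leq_trans (cnt_ltn _ _ _) _; lia.
apply: leq_trans (cntU _ _ _ _); apply: cnt_sub => i h1 h2 gi /=.
have [//|iJ] := ltnP i (n + stg J); apply/orP; right.
have si := sti i h1 h2.
have h0 := leq_stg c (leq0n J.+1).
apply: glitch_ncopied gi; rewrite ?si//; [|exact: ltnW|by lia].
rewrite copiedE si negb_and -leqNgt -leqNgt; apply/orP; right.
move: h; rewrite negb_and -!leqNgt => /orP[jJ'|]; last by lia.
have ej : j = J.+1 by lia.
by rewrite ej /=; rewrite ej in jn; lia.
Qed.

Lemma glitch_zero_banach : zero_banach glitch.
Proof.
(* Since [2 ^ J] exceeds [12 * K], a block contains few glitches: [4 * K * E <= stg J.+1]. A window
   at least as long as a block is covered by [b + 2 <= 3 * b] blocks. *)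
move=> K; pose J := (12 * K).
have S0 := stg_gt0 c J.+1.
pose E := 2 * stg J + stg J.+1 %/ 2 ^ J.
have HE : 4 * K * E <= stg J.+1.
  have h1 : 8 * K * stg J <= 2 ^ J * stg J.
    by rewrite leq_mul2r; apply/orP; right; apply: leq_trans (ltnW (ltn_expl J (ltnSn 1))); rewrite /J; lia.
  have h2 := stgS_big2 c2 J.
  have h3 : 2 ^ J * (stg J.+1 %/ 2 ^ J) <= stg J.+1 by rewrite mulnC leq_trunc_div.
  have h4 : 12 * K * (stg J.+1 %/ 2 ^ J) <= 2 ^ J * (stg J.+1 %/ 2 ^ J).
    by rewrite leq_mul2r; apply/orP; right; apply: ltnW (ltn_expl J (ltnSn 1)).
  by rewrite /E mulnDr; rewrite -!mulnA in h1 h2 h3 h4 *; lia.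
exists (stg J.+1) => n m nS.
pose a := m %/ stg J.+1; pose b := n %/ stg J.+1.
have h1 : cnt glitch m n <= (b + 2) * E.
  apply: leq_trans (_ : cnt glitch (a * stg J.+1) ((b + 2) * stg J.+1) <= _).
    apply: cnt_window; first exact: leq_trunc_div.
    have := divn_eq m (stg J.+1); have := divn_eq n (stg J.+1); rewrite -/a -/b.
    have := ltn_pmod m S0; have := ltn_pmod n S0; rewrite mulnDl; lia.
  by apply: cnt_blocks => q _; rewrite -mulnDl; exact: glitch_block.
have h2 : b * stg J.+1 <= n by exact: leq_trunc_div.
have h3 : K * cnt glitch m n <= K * ((b + 2) * E) by rewrite leq_mul2l h1 orbT.
have h4 : (b + 2) * (4 * K * E) <= (b + 2) * stg J.+1 by rewrite leq_mul2l HE orbT.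
rewrite mulnDl in h4; nia.
Qed.

End Glitches.
(** * Types and their densities *)

Section Types.
Local Open Scope nat_scope.
Variable c : nat.
Hypothesis c2 : 2 <= c.
Variables (thr : bool -> nat) (ext : nat).
Hypothesis thr_le4 : forall b, thr b <= 4.
Local Notation stg := (stg c).
Local Notation st := (st c2).
Local Notation copied := (copied c2).
Local Notation red := (red c2).
Local Notation cut := (cut c2).
Local Notation glitch := (glitch c2).

(* At time [n] the point follows the minimal sequence number [typ n]: after  *)
(* the copy, a stage [j] starts with a run of [2 ^ j] times of type [ext],   *)
(* and then types 0 and 1 alternate with period [4 * 2 ^ j].                 *)
Definition pat n := if (n %/ 2 ^ st n) %% 4 < thr (odd (st n)) then 0 else 1.
Definition early n := n < stg (st n) + stg (st n).-1 + 2 ^ st n.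
Definition base r := if early r then ext else pat r.
Definition typ n := base (red n).

(** The switches of [pat] and the end of an [early] stretch occur at multiples of [2 ^ st r], that
    is, at cuts. *)
Lemma base_succ r : ~~ cut r.+1 -> base r.+1 = base r.
Proof.
move=> nc; have [_ es] := ncut_st nc; move: nc; rewrite negb_or es => /andP[_ nd].
have ep : pat r.+1 = pat r by rewrite /pat es divnS ?pow2_ge1// (negbTE nd).
rewrite /base ep /early es; congr (if _ then _ else _).
rewrite [in RHS]leq_eqVlt; case: eqP => // e; case/negP: nd; rewrite e.
rewrite !dvdn_add//; first by apply: dvdn_trans (pow2_dvd_stg c2 _); rewrite dvdn_exp2l//; lia.
case: (st r) => [|j] /=; first by rewrite dvd1n.
by apply: dvdn_trans (pow2_dvd_stg c2 j); rewrite dvdn_exp2l.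
Qed.

Lemma typ_run n h : (forall i, i < h -> ~~ glitch (n + i)) ->
  forall i, i < h -> typ (n + i) = typ n.
Proof.
move=> H; elim=> [|i IH] ih; first by rewrite addn0.
have [_ h1 _] := red_run H (ltnW ih).
have ng := H _ ih; rewrite -(IH (ltnW ih)) addnS /typ.
have := red_succ; rewrite addnS in ng => /(_ _ _ _ ng) e.
by rewrite e; apply: base_succ; rewrite -e.
Qed.

Lemma copied_early n : copied n -> early n.
Proof. by move=> /andP[_ h]; rewrite /early (leq_trans h)// leq_addr. Qed.

Lemma typ_late n : ~~ early n -> typ n = pat n.
Proof.
move=> ne; have nc : ~~ copied n by apply: contra ne; exact: copied_early.
by rewrite /typ red_id// /base (negbTE ne).
Qed.

(** The early times up to the end of stage [J] all lie below [3 * stg J], and stage [J.+1] adds at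
    most [stg J + 2 ^ J.+1 <= 2 * stg J]. *)
Lemma early_cnt J n : stg J.+1 <= n -> n <= stg J.+2 -> cnt early 0 n <= 5 * stg J.
Proof.
move=> h1 h2; rewrite -(subnKC h1) cntD add0n.
have b1 := pow2_leq_stg c2 J; have b2 := leq_stg c (leq_pred J); have b3 := stgS_big c2 J.
have b4 := stg_gt0 c J.
have e1 : cnt early 0 (stg J.+1) <= 3 * stg J.
  rewrite -[leqRHS]subn0; apply: leq_trans (cnt_ltn _ _ (stg J.+1)).
  apply: cnt_sub => i _; rewrite add0n /early => iS ei; rewrite ltnNge; apply/negP => h.
  by have si : st i = J; [apply: st_eq => //; lia | rewrite si in ei; lia].
have e2 : cnt early (stg J.+1) (n - stg J.+1) <= 2 * stg J.
  rewrite -[leqRHS](addKn (stg J.+1)); apply: leq_trans (cnt_ltn _ _ (n - stg J.+1)).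
  apply: cnt_sub => i h3; rewrite subnKC// /early => h4.
  rewrite (st_eq c2 h3 (leq_trans h4 h2)) /= expnS; lia.
lia.
Qed.

Lemma early_zero_dens : zero_dens early.
Proof.
move=> K; exists (stg K.+1) => n Kn.
have n0 : stg 0 <= n by apply: leq_trans Kn; exact: leq_stg.
have := st_geq c2 Kn; case E : (st n) => [//|j] Kj; rewrite ltnS in Kj.
have h1 : stg j.+1 <= n by rewrite -E; exact: st_ge.
have h2 : n <= stg j.+2 by rewrite -E ltnW// st_lt.
have h3 := early_cnt h1 h2; have h4 := stgS_big2 c2 j.
have h5 : K * cnt early 0 n <= 2 ^ j * (5 * stg j).
  by apply: leq_mul => //; apply: leq_trans Kj (ltnW (ltn_expl j (ltnSn 1))).
by rewrite -!mulnA in h4 h5; lia.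
Qed.

(** For [t < 2], the number of quarters of type [t] in a period of [pat], in the stages of parity
    [b]; larger [t] receive the value of type 1 by default. *)
Definition wt (t : nat) (b : bool) := if t == 0 then thr b else 4 - thr b.

Lemma pat_cnt0 j e : stg j + e * (4 * 2 ^ j) <= stg j.+1 ->
  cnt (fun i => pat i == 0) (stg j) (e * (4 * 2 ^ j)) = e * (thr (odd j) * 2 ^ j).
Proof.
move=> he; apply: cnt_blocks_eq => q qe; set m := stg j + q * _.
have p0 := pow2_ge1 j.
have d1 : 4 * 2 ^ j %| stg j by have := pow2_dvd_stg c2 j; rewrite !expnS mulnA.
have dm : 4 * 2 ^ j %| m by apply: dvdn_add d1 _; exact: dvdn_mull.
have me : m + 4 * 2 ^ j <= stg j.+1.
  by apply: leq_trans he; rewrite /m -addnA leq_add2l -mulSnr leq_mul2r qe orbT.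
have patE i : m <= i -> i < m + 4 * 2 ^ j -> (pat i == 0) = (i < m + thr (odd j) * 2 ^ j).
  move=> h1 h2; have si : st i = j.
    by apply: st_eq; [apply: leq_trans h1; exact: leq_addr|exact: leq_trans me].
  rewrite /pat si -(subnKC h1) ltn_add2l; set i' := i - m.
  have i'4 : i' < 4 * 2 ^ j by rewrite /i'; lia.
  have -> : (m + i') %/ 2 ^ j %% 4 = i' %/ 2 ^ j.
    have /dvdnP[p ->] := dm; rewrite mulnA divnMDl// modnMDl modn_small//.
    by rewrite ltn_divLR.
  by rewrite ltn_divLR//; case: ifP.
rewrite (eq_cnt patE) -(subnKC (leq_mul (thr_le4 (odd j)) (leqnn (2 ^ j)))) cntD.
rewrite cnt_predT// cnt_pred0 ?addn0// => i h1 _.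
by rewrite -leqNgt.
Qed.

Lemma pat_cnt t j e : t < 2 -> stg j + e * (4 * 2 ^ j) <= stg j.+1 ->
  cnt (fun i => pat i == t) (stg j) (e * (4 * 2 ^ j)) = e * (wt t (odd j) * 2 ^ j).
Proof.
case: t => [|[|//]] _ he; first exact: pat_cnt0.
have := cntC (fun i => pat i == 0) (stg j) (e * (4 * 2 ^ j)); rewrite pat_cnt0// /wt /=.
have -> : cnt (predC (fun i => pat i == 0)) (stg j) (e * (4 * 2 ^ j)) =
    cnt (fun i => pat i == 1) (stg j) (e * (4 * 2 ^ j)).
  by apply: eq_cnt => i _ _ /=; rewrite /pat; case: ifP.
rewrite mulnBl mulnBr => h; rewrite -[in RHS]h addKn//.
Qed.

Lemma cnt_typ_pat t m n : cnt (fun i => typ i == t) m n <=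
  cnt (fun i => pat i == t) m n + cnt early m n /\
  cnt (fun i => pat i == t) m n <= cnt (fun i => typ i == t) m n + cnt early m n.
Proof.
split; apply: leq_trans (cntU _ _ _ _); apply: cnt_sub => i _ _ h; apply/orP;
  have [|/typ_late e] := boolP (early i); [by right|by left; rewrite -e|by right|by left; rewrite e].
Qed.

(** At the end of stage [j] the proportion of type [t] is [wt t (odd j) / 4] up to an error of order
    [2 ^- j], because the previous stages and the early times are negligible against [stg j.+1]. *)
Lemma typ_stage t j : t < 2 -> 0 < j ->
  2 ^ j * (4 * cnt (fun i => typ i == t) 0 (stg j.+1)) <= (2 ^ j * wt t (odd j) + 1) * stg j.+1 /\
  2 ^ j * wt t (odd j) * stg j.+1 <= 2 ^ j * (4 * cnt (fun i => typ i == t) 0 (stg j.+1)) + stg j.+1.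
Proof.
case: j => // J t2 _; set j := J.+1.
have d1 : 4 * 2 ^ j %| stg j by have := pow2_dvd_stg c2 j; rewrite !expnS mulnA.
have d2 : 4 * 2 ^ j %| stg j.+1 by apply: dvdn_trans d1 (stg_dvd _ _).
have jj : stg j <= stg j.+1 := leq_stg c (leqnSn j).
have /dvdnP[e He] : 4 * 2 ^ j %| stg j.+1 - stg j by rewrite dvdn_sub.
have := @pat_cnt t j e t2; rewrite -He subnKC// => /(_ (leqnn _)) Hp.
have Hp4 : 4 * cnt (fun i => pat i == t) (stg j) (stg j.+1 - stg j) =
    wt t (odd j) * (stg j.+1 - stg j) by rewrite Hp He; lia.
have [q1 q2] := cnt_typ_pat t (stg j) (stg j.+1 - stg j).
have he := early_cnt jj (leqnn (stg j.+1)).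
have He1 : cnt early 0 (stg j.+1) = cnt early 0 (stg j) + cnt early (stg j) (stg j.+1 - stg j).
  by rewrite -{1}(subnKC jj) cntD.
have Ht : cnt (fun i => typ i == t) 0 (stg j.+1) = cnt (fun i => typ i == t) 0 (stg j) +
   cnt (fun i => typ i == t) (stg j) (stg j.+1 - stg j).
  by rewrite -{1}(subnKC jj) cntD.
have Ht0 := cnt_le (fun i => typ i == t) 0 (stg j).
have b1 := stgS_big c2 J; rewrite -/j in b1.
have b2 := stgS_big2 c2 j.
have w4 : wt t (odd j) <= 4 by rewrite /wt; case: ifP => // _; exact: leq_subr.
have w5 : wt t (odd j) * (stg j.+1 - stg j) + wt t (odd j) * stg j = wt t (odd j) * stg j.+1.
  by rewrite -mulnDr subnK.
have w6 : wt t (odd j) * stg j <= 4 * stg j by rewrite leq_mul2r w4 orbT.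
set C := cnt _ 0 (stg j.+1) in Ht *; set W := wt t (odd j) * stg j.+1 in w5.
have h1 : 4 * C <= W + 5 * stg j by lia.
have h2 : W <= 4 * C + 5 * stg j by lia.
have h3 : 2 ^ j * (5 * stg j) <= stg j.+1 by rewrite -!mulnA in b2; lia.
split.
  apply: leq_trans (_ : 2 ^ j * (W + 5 * stg j) <= _); first by rewrite leq_mul2l h1 orbT.
  by rewrite mulnDr mulnDl mul1n -mulnA leq_add2l.
rewrite -mulnA -/W; apply: leq_trans (_ : 2 ^ j * (4 * C + 5 * stg j) <= _).
  by rewrite leq_mul2l h2 orbT.
by rewrite mulnDr leq_add2l.
Qed.

(** Whole periods of the last finished stage and of the current one contain at least a quarter of
    type [t]; the factor 16 absorbs the older times, the early times and the unfinished period. *)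
Lemma typ_lower t n : t < 2 -> (forall b, 0 < wt t b) -> stg 1 <= n ->
  n <= 16 * cnt (fun i => typ i == t) 0 n.
Proof.
move=> t2 w0 n1; have := st_geq c2 n1; case E : (st n) => [//|j] _.
have n0 : stg 0 <= n by apply: leq_trans n1; exact: leq_stg.
have h1 : stg j.+1 <= n by rewrite -E; exact: st_ge.
have h2 : n < stg j.+2 by rewrite -E st_lt.
have [_ q2] := cnt_typ_pat t 0 n; have he := early_cnt h1 (ltnW h2).
have jj : stg j <= stg j.+1 := leq_stg c (leqnSn j).
have d1 : 4 * 2 ^ j %| stg j by have := pow2_dvd_stg c2 j; rewrite !expnS mulnA.
have d2 : 4 * 2 ^ j %| stg j.+1 by apply: dvdn_trans d1 (stg_dvd _ _).
have /dvdnP[e He] : 4 * 2 ^ j %| stg j.+1 - stg j by rewrite dvdn_sub.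
have := @pat_cnt t j e t2; rewrite -He subnKC// => /(_ (leqnn _)) Hp.
have c1 : stg j.+1 - stg j <= 4 * cnt (fun i => pat i == t) (stg j) (stg j.+1 - stg j).
  rewrite Hp He; apply: leq_trans (_ : e * (4 * 2 ^ j) * wt t (odd j) <= _); last by lia.
  by rewrite leq_pmulr.
pose e' := (n - stg j.+1) %/ (4 * 2 ^ j.+1).
have He' : e' * (4 * 2 ^ j.+1) <= n - stg j.+1 by exact: leq_trunc_div.
have := @pat_cnt t j.+1 e' t2 => /(_ _)/wrap[]; first by lia.
move=> Hp'.
have c3 : e' * (4 * 2 ^ j.+1) <= 4 * cnt (fun i => pat i == t) (stg j.+1) (n - stg j.+1).
  apply: leq_trans (_ : 4 * cnt (fun i => pat i == t) (stg j.+1) (e' * (4 * 2 ^ j.+1)) <= _).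
    rewrite Hp'; apply: leq_trans (_ : e' * (4 * 2 ^ j.+1) * wt t (odd j.+1) <= _); last by lia.
    by rewrite leq_pmulr.
  by rewrite leq_mul2l cnt_window// leq_add2l.
have c4 : n - stg j.+1 < e' * (4 * 2 ^ j.+1) + 4 * 2 ^ j.+1.
  by rewrite {1}(divn_eq (n - stg j.+1) (4 * 2 ^ j.+1)) ltn_add2l ltn_pmod// muln_gt0 pow2_ge1.
have c5 : cnt (fun i => pat i == t) 0 n = cnt (fun i => pat i == t) 0 (stg j) +
   cnt (fun i => pat i == t) (stg j) (stg j.+1 - stg j) +
   cnt (fun i => pat i == t) (stg j.+1) (n - stg j.+1).
  by rewrite -{1}(subnKC h1) -{1}(subnKC jj) !cntD !add0n subnKC.
have b1 := stgS_big c2 j; have b2 := pow2_leq_stg c2 j; rewrite expnS in c4.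
rewrite expnS in c3; lia.
Qed.

(** From [2 * stg j] on nothing is early, and each quarter of the first period there is a window of
    length [2 ^ j] of a single type, which Banach densities detect. *)
Lemma typ_window j r i : 0 < j -> r < 4 -> 2 * stg j + r * 2 ^ j <= i ->
  i < 2 * stg j + r * 2 ^ j + 2 ^ j -> typ i = if r < thr (odd j) then 0 else 1.
Proof.
move=> j0 r4 h1 h2; have b1 := stgS_big c2 j; have b2 := pow2_leq_stg c2 j.
have b3 := stg_gt0 c j; have b4 := pow2_ge1 j.
have r5 : r * 2 ^ j + 2 ^ j <= 4 * 2 ^ j by rewrite -mulSnr leq_mul2r r4 orbT.
have si : st i = j by apply: st_eq; lia.
have b5 : stg j.-1 + 2 ^ j <= stg j.
  by have := stgS_big c2 j.-1; rewrite prednK//; lia.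
rewrite typ_late; last by rewrite /early si -leqNgt; lia.
rewrite /pat si; suff -> : (i %/ 2 ^ j) %% 4 = r by [].
have d1 : 4 * 2 ^ j %| 2 * stg j.
  by rewrite dvdn_mull//; have := pow2_dvd_stg c2 j; rewrite !expnS mulnA.
have /dvdnP[p Ep] := d1; rewrite Ep in h1 h2.
have -> : i = (p * 4 + r) * 2 ^ j + (i - (p * 4 + r) * 2 ^ j).
  by rewrite subnKC// mulnDl -mulnA.
rewrite divnMDl// divn_small ?addn0; last by rewrite ltn_subLR mulnDl -mulnA.
by rewrite modnMDl modn_small.
Qed.

Lemma typ_early_window j i : 0 < j -> stg j + stg j.-1 <= i ->
  i < stg j + stg j.-1 + 2 ^ j -> typ i = ext.
Proof.
move=> j0 h1 h2; have b1 := stgS_big c2 j; have b2 := pow2_leq_stg c2 j.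
have b6 := leq_stg c (leq_pred j); have b3 := stg_gt0 c j.
have si : st i = j by apply: st_eq; lia.
rewrite /typ red_id; last by rewrite copiedE si negb_and -!leqNgt h1 orbT.
by rewrite /base /early si h2.
Qed.

End Types.

(** * Positivity of densities in integer form *)

Section Positivity.
Local Open Scope nat_scope.

Inductive density := UpperD | LowerD | UpperB | LowerB.

(** The four densities differ only in the quantifiers over windows of length [n] starting at [m],
    where [m] is 0 for the asymptotic ones. *)
Definition often (Q : density) (P : nat -> nat -> Prop) : Prop :=
  match Q with
  | UpperD => forall n0, exists n, n0 <= n /\ P n 0
  | LowerD => exists n0, forall n, n0 <= n -> P n 0
  | UpperB => forall n0, exists n m, n0 <= n /\ P n m
  | LowerB => exists n0, forall n m, n0 <= n -> P n m
  end.

Definition pos Q (S : pred nat) := exists K, often Q (fun n m => n <= K * cnt S m n).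

Lemma often_sub Q (P P' : nat -> nat -> Prop) n0 :
  (forall n m, n0 <= n -> P n m -> P' n m) -> often Q P -> often Q P'.
Proof.
move=> H; case: Q => /=.
- move=> h n1; have [n [nn Pn]] := h (n0 + n1); exists n; split.
    by apply: leq_trans nn; exact: leq_addl.
  by apply: H Pn; apply: leq_trans nn; exact: leq_addr.
- move=> [n1 h]; exists (n0 + n1) => n nn.
  apply: H; first by apply: leq_trans nn; exact: leq_addr.
  by apply: h; apply: leq_trans nn; exact: leq_addl.
- move=> h n1; have [n [m [nn Pn]]] := h (n0 + n1); exists n, m; split.
    by apply: leq_trans nn; exact: leq_addl.
  by apply: H Pn; apply: leq_trans nn; exact: leq_addr.
- move=> [n1 h]; exists (n0 + n1) => n m nn.
  apply: H; first by apply: leq_trans nn; exact: leq_addr.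
  by apply: h; apply: leq_trans nn; exact: leq_addl.
Qed.

Lemma often_False Q (P : nat -> nat -> Prop) n0 :
  (forall n m, n0 <= n -> ~ P n m) -> ~ often Q P.
Proof.
move=> H; case: Q => /=.
- by move=> /(_ n0)[n [nn]]; exact: H.
- by move=> [n1 /(_ (n0 + n1) (leq_addl _ _))]; apply: H; exact: leq_addr.
- by move=> /(_ n0)[n [m [nn]]]; exact: H.
- by move=> [n1 /(_ (n0 + n1) 0 (leq_addl _ _))]; apply: H; exact: leq_addr.
Qed.

Lemma pos_sub Q (S T : pred nat) K C n0 : 
  (forall n m, n0 <= n -> cnt S m n <= K * cnt T m n + C) -> pos Q S -> pos Q T.
Proof.
move=> H [K' h]; exists (2 * (K' * K)); apply: (@often_sub _ _ _ (n0 + 2 * (K' * C))) h.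
move=> n m nn hn; have /H hm : n0 <= n by apply: leq_trans nn; exact: leq_addr.
have : K' * cnt S m n <= K' * (K * cnt T m n + C) by rewrite leq_mul2l hm orbT.
rewrite mulnDr -!mulnA; lia.
Qed.

(** In long windows [Z] and the constant account for at most [n / 2] and [n / 4]; a quarter is left
    for [T], whichever of the four densities is meant. *)
Lemma pos_zero_banach_sub Q (S T Z : pred nat) K C : zero_banach Z ->
  (forall n m, cnt S m n <= K * cnt T m n + cnt Z m n + C) -> pos Q S -> pos Q T.
Proof.
move=> zZ H [K' h]; have [n0 Hn0] := zZ (2 * K').
exists (4 * (K' * K)); apply: (@often_sub _ _ _ (n0 + 4 * (K' * C))) h.
move=> n m nn hn; have /Hn0-/(_ m) hm : n0 <= n by apply: leq_trans nn; exact: leq_addr.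
have : K' * cnt S m n <= K' * (K * cnt T m n + cnt Z m n + C) by rewrite leq_mul2l H orbT.
rewrite !mulnDr -!mulnA in hm *; lia.
Qed.

Lemma not_pos_zero_banach Q S : zero_banach S -> ~ pos Q S.
Proof.
move=> zS [K]; have [n0 H] := zS (2 * K); apply: (@often_False _ _ n0.+1) => n m nn hn.
by have := H n m (ltnW nn); rewrite -mulnA; lia.
Qed.

Lemma pos_L_U S : pos LowerD S -> pos UpperD S.
Proof.
move=> [K [n0 H]]; exists K => n1; exists (n0 + n1); split; first exact: leq_addl.
by apply: H; exact: leq_addr.
Qed.

Lemma pos_U_UB S : pos UpperD S -> pos UpperB S.
Proof. by move=> [K H]; exists K => n0; have [n [h1 h2]] := H n0; exists n, 0. Qed.

End Positivity.

Section TypePositivity.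
Local Open Scope nat_scope.
Variable c : nat.
Hypothesis c2 : 2 <= c.
Variables (thr : bool -> nat) (ext : nat).
Hypothesis thr_le4 : forall b, thr b <= 4.
Local Notation stg := (stg c).
Local Notation st := (st c2).
Local Notation typ := (typ c2 thr ext).
Local Notation wt := (wt thr).

Let tyq t : pred nat := fun i => typ i == t.

Let parity (b : bool) n0 : exists j, [/\ n0 <= 2 ^ j, 0 < j & odd j = b].
Proof.
exists (2 * n0.+1 + b); split; last by rewrite oddD mul2n odd_double; case: b.
  by apply: leq_trans (ltnW (ltn_expl _ (ltnSn 1))); lia.
by rewrite addn_gt0.
Qed.

(** Types from 2 on occur at early times only, and a type of weight 0 in one parity has vanishing
    proportion at the ends of the stages of that parity. *)
Lemma typ_pos_L t : pos LowerD (tyq t) <-> t < 2 /\ forall b, 0 < wt t b.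
Proof.
split; last by move=> [t2 w]; exists 16, (stg 1) => n nn; exact: typ_lower.
move=> [K [n0 H]]; have t2 : t < 2.
  rewrite ltnNge; apply/negP => t2.
  have [n1 H1] := early_zero_dens c2 K.*2.
  have := H (n0 + n1).+1; rewrite leqW ?leq_addr// => /(_ isT) h.
  have := H1 (n0 + n1).+1; rewrite leqW ?leq_addl// => /(_ isT) h1.
  have : cnt (tyq t) 0 (n0 + n1).+1 <= cnt (early c2) 0 (n0 + n1).+1.
    apply: cnt_sub => i _ _ /eqP; apply: contraPT => /(typ_late thr ext) ->.
    by rewrite /pat; case: ifP => _ e; move: t2; rewrite -e.
  move=> h2; have : K * cnt (tyq t) 0 (n0 + n1).+1 <= K * cnt (early c2) 0 (n0 + n1).+1.
    by rewrite leq_mul2l h2 orbT.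
  by rewrite -mul2n -mulnA in h1; lia.
split => // b; rewrite lt0n; apply/eqP => w0.
have [j [jn j0 jb]] := parity b (n0 + K).
have [h _] := typ_stage c2 ext thr_le4 t2 j0; rewrite jb w0 muln0 add0n mul1n in h.
have h2 : 2 ^ j <= stg j.+1.
  by have := pow2_leq_stg c2 j; have := stgS_big c2 j; lia.
have := H (stg j.+1) _; rewrite (leq_trans _ h2) ?(leq_trans _ jn) ?leq_addr// => /(_ isT).
set C := cnt _ _ _ in h *; have s0 := stg_gt0 c j.+1 => h3.
have : K * C <= 2 ^ j * C by rewrite leq_mul2r (leq_trans _ jn) ?leq_addl ?orbT.
by rewrite mulnCA in h; lia.
Qed.

Hypothesis thr_false : 0 < thr false.
Hypothesis thr_true : thr true < 4.

(** The first quarter of a period has type 0 in even stages and the last quarter has type 1 in odd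
    stages, so arbitrarily long windows avoid any given type. *)
Lemma typ_pos_LB t : ~ pos LowerB (tyq t).
Proof.
move=> [K [n0 H]].
have [b [r [r4 ne]]] : exists b r, r < 4 /\ (if r < thr b then 0 else 1) != t.
  case: t H => [|t] H; last by exists false, 0; rewrite thr_false.
  by exists true, 3; split => //; rewrite ltnNge (_ : thr true <= 3).
have [j [jn j0 jb]] := parity b n0.
have := H (2 ^ j) (2 * stg j + r * 2 ^ j) jn.
rewrite cnt_pred0 ?muln0 ?leqn0 ?expn_eq0// => i h1 h2.
by rewrite /tyq (typ_window c2 _ _ j0 r4 h1 h2)// jb.
Qed.

Lemma typ_pos_U t : pos UpperD (tyq t) <-> t < 2 /\ exists b, 0 < wt t b.
Proof.
split.
  move=> [K H]; have t2 : t < 2.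
    rewrite ltnNge; apply/negP => t2.
    have [n1 H1] := early_zero_dens c2 K.*2.
    have [n [n1n h]] := H n1.+1; have h1 := H1 n (ltnW n1n).
    have h2 : cnt (tyq t) 0 n <= cnt (early c2) 0 n.
      apply: cnt_sub => i _ _ /eqP; apply: contraPT => /(typ_late thr ext) ->.
      by rewrite /pat; case: ifP => _ e; move: t2; rewrite -e.
    have : K * cnt (tyq t) 0 n <= K * cnt (early c2) 0 n by rewrite leq_mul2l h2 orbT.
    by rewrite -mul2n -mulnA in h1; lia.
  split => //; case: t t2 H => [|[|//]] _ H; first by exists false.
  by exists true; rewrite /wt subn_gt0.
move=> [t2 [b wb]]; exists 8 => n0.
have [j [jn j0 jb]] := parity b (n0 + 2); exists (stg j.+1).
have h2 : 2 ^ j <= stg j.+1.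
  by have := pow2_leq_stg c2 j; have := stgS_big c2 j; lia.
split; first by apply: leq_trans h2; apply: leq_trans jn; exact: leq_addr.
have [_ h] := typ_stage c2 ext thr_le4 t2 j0; rewrite jb in h.
rewrite -(leq_pmul2l (pow2_ge1 j)).
have h3 : 2 ^ j * stg j.+1 <= 2 ^ j * wt t b * stg j.+1.
  by rewrite leq_mul2r leq_pmulr ?orbT.
have h4 : 2 * stg j.+1 <= 2 ^ j * stg j.+1 by rewrite leq_mul2r (leq_trans _ jn) ?leq_addl ?orbT.
set C := cnt _ _ _ in h *; have -> : 2 ^ j * (8 * C) = 2 * (2 ^ j * (4 * C)) by lia.
lia.
Qed.

(** The initial runs of length [2 ^ j] provide arbitrarily long windows of type [ext], although by
    themselves they are too sparse for the upper density. *)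
Lemma typ_pos_UB t : pos UpperB (tyq t) <-> t < 2 \/ t = ext.
Proof.
split; last first.
  move=> [t2|te].
    apply/pos_U_UB/typ_pos_U; split => //.
    case: t t2 => [|[|//]] _; first by exists false.
    by exists true; rewrite /wt subn_gt0.
  exists 1 => n0; have [j [jn j0 _]] := parity true n0.
  exists (2 ^ j), (stg j + stg j.-1); split => //.
  rewrite mul1n cnt_predT// => i h1 h2.
  by rewrite /tyq (typ_early_window c2 _ _ j0 h1 h2) te.
move=> [K H]; have [t2|t2] := ltnP t 2; [by left|right].
have [n [m [n1]]] := H 1; case: (eqVneq t ext) => // ne.
rewrite cnt_pred0 ?muln0; first by lia.
move=> i _ _; rewrite /tyq /typ /base; case: ifP => _; first by rewrite eq_sym.
by rewrite /pat; case: ifP => _; apply: contraTN t2 => /eqP<-.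
Qed.

End TypePositivity.

(** * From densities in the extended reals to integer inequalities *)

Section LimSup.
Variable R : realType.
Local Open Scope ereal_scope.
Implicit Types u : nat -> \bar R.

Lemma limn_esup_gt0 u : 0 < limn_esup u <->
  exists e : R, (0 < e)%R /\ forall n0, exists n, (n0 <= n)%N /\ e%:E <= u n.
Proof.
rewrite limn_esup_lim (cvg_lim _ (@cvg_esups_inf R u))//; split=> [h|[e [e0 H]]].
  have [e e0 He] : exists2 e : R, (0 < e)%R & e%:E < ereal_inf (range (esups u)).
    case: ereal_inf h => [r| |//]; rewrite ?lte_fin => r0.
      by exists (r / 2)%R; [rewrite divr_gt0|rewrite lte_fin; lra].
    by exists 1%R => //; exact: ltry.
  exists e; split => // n0.
  have /ereal_sup_gt[_ [n nn <-] en] : e%:E < esups u n0.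
    by apply: lt_le_trans He _; apply: ereal_inf_lbound; exists n0.
  by exists n; split => //; exact: ltW.
apply: (@lt_le_trans _ _ e%:E); first by rewrite lte_fin.
apply: le_ereal_inf_tmp => _ [n0 _ <-]; have [n [nn en]] := H n0.
by apply: le_trans en _; apply: ereal_sup_ubound; exists n.
Qed.

Lemma limn_einf_gt0 u : 0 < limn_einf u <->
  exists e : R, (0 < e)%R /\ exists n0, forall n, (n0 <= n)%N -> e%:E <= u n.
Proof.
rewrite limn_einf_lim (cvg_lim _ (@cvg_einfs_sup R u))//; split=> [|[e [e0 [n0 H]]]].
  move=> /ereal_sup_gt[_ [n0 _ <-] h].
  have [e e0 He] : exists2 e : R, (0 < e)%R & e%:E < einfs u n0.
    case: (einfs u n0) h => [r| |//]; rewrite ?lte_fin => r0.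
      by exists (r / 2)%R; [rewrite divr_gt0|rewrite lte_fin; lra].
    by exists 1%R => //; exact: ltry.
  exists e; split => //; exists n0 => n nn; apply: le_trans (ltW He) _.
  by apply: ereal_inf_lbound; exists n.
apply: (@lt_le_trans _ _ e%:E); first by rewrite lte_fin.
apply: (@le_trans _ _ (einfs u n0)).
  by apply: le_ereal_inf_tmp => _ [n nn <-]; exact: H.
by apply: ereal_sup_ubound; exists n0.
Qed.

End LimSup.

Section Densities.
Variable R : realType.

Definition dens_of Q : set nat -> \bar R :=
  match Q with
  | UpperD => @upper_dens R
  | LowerD => @lower_dens R
  | UpperB => @banach_upper R
  | LowerB => @banach_lower R
  end.

Lemma count_inE (S : set nat) m n :
  count_in R S m n = (cnt (fun i => `[< S i >]) m n)%:R.
Proof.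
rewrite /count_in /cnt -{1}[m]add0n big_addn addKn big_mkord natr_sum.
by apply: eq_bigr => i _; rewrite addnC; case: ifP.
Qed.

Let ratio_nat (e : R) (a n : nat) : 0 < e -> (0 < n)%N -> e <= a%:R / n%:R ->
  (n <= (Num.truncn e^-1).+1 * a)%N.
Proof.
move=> e0 n0; rewrite ler_pdivlMr ?ltr0n// => h.
rewrite -(ler_nat R) natrM; apply: (@le_trans _ _ (e^-1 * a%:R)).
  by rewrite ler_pdivlMl.
by rewrite ler_wpM2r ?ler0n// ltW// truncnS_gt.
Qed.

Let nat_ratio K (a n : nat) : (0 < n)%N -> (n <= K * a)%N -> K.+1%:R^-1 <= a%:R / n%:R :> R.
Proof.
move=> n0 h; rewrite ler_pdivlMr ?ltr0n// ler_pdivrMl// -natrM ler_nat.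
by apply: leq_trans h _; rewrite leq_mul2r leqnSn orbT.
Qed.

(** The densities count from 1, or from [m.+1], whereas the windows of [cnt] start at [m]; hence the
    successor, which [pos_succ] removes. *)
Lemma dens_pos Q (S : set nat) : (0 < dens_of Q S)%E <-> pos Q (fun i => `[< S i.+1 >]).
Proof.
have cS m n : cnt (fun i => `[< S i.+1 >]) m n = cnt (fun i => `[< S i >]) m.+1 n by [].
case: Q => /=.
- rewrite /upper_dens limn_esup_gt0; split.
    move=> [e [e0 H]]; exists (Num.truncn e^-1).+1 => n0.
    have [n [nn]] := H n0.+1; rewrite lee_fin count_inE => h.
    by exists n; rewrite (ltnW nn); split => //; apply: ratio_nat => //; exact: leq_trans nn.
  move=> [K H]; exists K.+1%:R^-1; split; first by rewrite invr_gt0.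
  move=> n0; have [n [nn h]] := H n0.+1; exists n; rewrite (ltnW nn); split => //.
  by rewrite lee_fin count_inE; apply: nat_ratio => //; exact: leq_trans nn.
- rewrite /lower_dens limn_einf_gt0; split.
    move=> [e [e0 [n0 H]]]; exists (Num.truncn e^-1).+1; exists n0.+1 => n nn.
    have := H n (ltnW nn); rewrite lee_fin count_inE => h.
    by apply: ratio_nat => //; exact: leq_trans nn.
  move=> [K [n0 H]]; exists K.+1%:R^-1; split; first by rewrite invr_gt0.
  exists n0.+1 => n nn; rewrite lee_fin count_inE.
  by apply: nat_ratio (H n (ltnW nn)); exact: leq_trans nn.
- rewrite /banach_upper limn_esup_gt0; split.
    (* The supremum over [m] need not be attained, so a window is only found above [e / 2]. *)
    move=> [e [e0 H]]; exists (Num.truncn (e / 2)^-1).+1 => n0.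
    have [n [nn h]] := H n0.+1.
    have : ((e / 2)%:E < e%:E)%E by rewrite lte_fin; lra.
    move=> /lt_le_trans/(_ h)/ereal_sup_gt[_ [m _ <-]]; rewrite lte_fin count_inE => /ltW h'.
    exists n, m; rewrite (ltnW nn); split => //.
    by apply: ratio_nat => //; [rewrite divr_gt0|exact: leq_trans nn].
  move=> [K H]; exists K.+1%:R^-1; split; first by rewrite invr_gt0.
  move=> n0; have [n [m [nn h]]] := H n0.+1; exists n; rewrite (ltnW nn); split => //.
  apply: le_trans (_ : (count_in R S m.+1 n / n%:R)%:E <= _)%E; last first.
    by apply: ereal_sup_ubound; exists m.
  by rewrite lee_fin count_inE; apply: nat_ratio => //; exact: leq_trans nn.
- rewrite /banach_lower limn_einf_gt0; split.
    move=> [e [e0 [n0 H]]]; exists (Num.truncn e^-1).+1; exists n0.+1 => n m nn.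
    have := H n (ltnW nn) => h.
    have : (e%:E <= (count_in R S m.+1 n / n%:R)%:E)%E.
      by apply: le_trans h _; apply: ereal_inf_lbound; exists m.
    rewrite lee_fin count_inE => h'.
    by apply: ratio_nat => //; exact: leq_trans nn.
  move=> [K [n0 H]]; exists K.+1%:R^-1; split; first by rewrite invr_gt0.
  exists n0.+1 => n nn; apply: le_ereal_inf_tmp => _ [m _ <-].
  rewrite lee_fin count_inE.
  by apply: nat_ratio (H n m (ltnW nn)); exact: leq_trans nn.
Qed.

Lemma pos_succ Q (S : pred nat) : pos Q (fun i => S i.+1) <-> pos Q S.
Proof.
have cS m n : cnt (fun i => S i.+1) m n = cnt S m.+1 n by [].
have e1 m n : (cnt S m 1 + cnt S m.+1 n = cnt S m n + cnt S (m + n)%N 1)%N.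
  by rewrite -cntD addn1 -[m.+1]addn1 -cntD add1n.
have b m : (cnt S m 1 <= 1)%N := cnt_le S m 1.
split; apply: (@pos_sub _ _ _ 1 1 0) => n m _; rewrite mul1n cS.
  by have := e1 m n; have := b (m + n)%N; lia.
by have := e1 m n; have := b m; lia.
Qed.

Variable k : nat.
Implicit Types x y : Sigma k.

Lemma omega_densP Q x y : omega_dens (dens_of Q) x y <->
  forall h, pos Q (fun i => `[< agree h y (shiftn i x) >]).
Proof.
have V e : (0 < dens_of Q (visits x (ball_d y e)))%E <->
    pos Q (fun i => `[< ball_d y e (shiftn i x) >]).
  rewrite dens_pos -[X in _ <-> X]pos_succ; suff -> : (fun i => `[< visits x (ball_d y e) i.+1 >]) =
    (fun i => `[< ball_d y e (shiftn i.+1 x) >]) by [].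
  by apply/funext => i; apply/asboolP/asboolP => [[]|].
split=> [H h|H e e0].
  have e0 : 0 < (2 ^- h : R) by rewrite invr_gt0 exprn_gt0.
  have /V := H _ e0; apply: (@pos_sub _ _ _ 1 0 0) => n m _; rewrite mul1n addn0.
  apply: cnt_sub => i _ _ /asboolP h'; apply/asboolP; apply: agree_sym; exact: agree_dist h'.
apply/V; have [h hb] := ball_agree y e0.
apply: (@pos_sub _ _ _ 1 0 0) (H h) => n m _; rewrite mul1n addn0.
by apply: cnt_sub => i _ _ /asboolP h'; apply/asboolP/hb/agree_sym.
Qed.

End Densities.
(** * The points and their omega-limit sets *)

Section Point.
Variables (R : realType) (k : nat).
Variables (z : nat -> Sigma k) (U : Sigma k) (w c : nat).
Hypothesis c2 : (2 <= c)%N.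
Variables (thr : bool -> nat) (ext : nat).
Hypothesis ext02 : ext = 0%N \/ ext = 2%N.

Local Notation stg := (stg c).
Local Notation st := (st c2).
Local Notation red := (red c2).
Local Notation glitch := (glitch c2).
Local Notation typ := (typ c2 thr ext).
Local Notation base := (base c2 thr ext).

Definition orbit_closure t : set (Sigma k) :=
  [set y | forall h, exists m, agree h y (shiftn m (z t))].

Hypothesis z_rec : forall t, (t < 3)%N -> forall h, exists K, forall m,
  exists i, (i < K)%N /\ agree h (z t) (shiftn (m + i) (z t)).
Hypothesis z_sep : forall s t y, (s < 3)%N -> (t < 3)%N ->
  orbit_closure s y -> orbit_closure t y -> s = t.

(* Every bit of [pr] is read off at infinitely many stages, all odd.       *)
Definition bit (pr : nat -> bool) j : nat :=
  if logn 2 j.+1 is r.+1 then pr r else 0%N.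

Definition basept pr r : Alph k :=
  if (r < stg 0)%N then U r else z (base r) (r + bit pr (st r)).
Definition point pr : Sigma k := fun n => basept pr (red n).

Lemma pointE pr n : point pr n = basept pr (red n). Proof. by []. Qed.

Variable pr : nat -> bool.
Local Notation x := (point pr).

Lemma typ_lt3 n : (typ n < 3)%N.
Proof.
rewrite /typ /base; case: ifP => _; first by case: ext02 => ->.
by rewrite /pat; case: ifP.
Qed.

(** Without a glitch ahead, [red] is a translation and both the type and the bit are constant, so
    one stretch of a single minimal sequence is read. *)
Lemma point_run n h : ~~ nearby glitch h n ->
  agree h (shiftn n x) (shiftn (red n + bit pr (st (red n))) (z (typ n))).
Proof.
move=> ng; have H i : (i < h)%N -> ~~ glitch (n + i).
  by move=> ih; apply: contra ng => g; apply/existsP; exists (Ordinal ih).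
move=> i ih; have [h0 h1 h2] := red_run H ih.
have ht := typ_run thr ext H ih.
rewrite /shiftn /point /basept h1 ltnNge (leq_trans h0) ?leq_addr//= h2.
by rewrite -[base _]/(base (red n + i)%N) -h1 -[base _]/(typ (n + i)%N) ht h1 addnAC.
Qed.

(** The prefix of [y] occurs at [m0] inside the prefix of [z t] of length [m0 + h], which returns
    with bounded gaps. *)
Lemma orbit_closure_syndetic t y h : (t < 3)%N -> orbit_closure t y ->
  exists K, forall m, exists i, (i < K)%N /\ agree h y (shiftn (m + i) (z t)).
Proof.
move=> t3 /(_ h)[m0 Hm0]; have [K HK] := z_rec t3 (m0 + h)%N.
exists (K + m0)%N => m; have [i [iK Hi]] := HK m.
exists (i + m0)%N; rewrite ltn_add2r; split => //.
apply: agree_trans Hm0 _; rewrite addnA -shiftnD; exact: agree_shiftn.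
Qed.

Let V h y : pred nat := fun i => `[< agree h y (shiftn i x) >].

(** A time of type [t] with no glitch soon after is followed within [K] steps by a visit. Times near
    glitches do not affect positivity, and [nearby] multiplies counts by at most [K] up to a
    constant. *)
Lemma pos_visit Q t y h : (t < 3)%N -> orbit_closure t y ->
  pos Q (fun i => typ i == t) -> pos Q (V h y).
Proof.
move=> t3 yt; have [K HK] := orbit_closure_syndetic h t3 yt.
apply: (@pos_zero_banach_sub _ _ _ _ K (K * K) (@zero_banach_nearby _ (K + h) (glitch_zero_banach c2))).
move=> n m; apply: leq_trans (_ : cnt (nearby (V h y) K) m n + cnt (nearby glitch (K + h)) m n <= _)%N; last first.
  by have := nearby_cnt_le (V h y) K m n; rewrite mulnDr; lia.
apply: leq_trans (cntU _ _ _ _); apply: cnt_sub => i _ _ /eqP ti.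
apply/orP; have [|ng] := boolP (nearby glitch (K + h) i); first by right.
left; have [j [jK Hj]] := HK (red i + bit pr (st (red i)))%N.
apply/existsP; exists (Ordinal jK); apply/asboolP => /=.
apply: agree_trans Hj _; rewrite -shiftnD -(shiftnD j); apply: agree_shiftn.
apply: agree_sym; have := point_run ng; rewrite ti; apply: agreeS.
by rewrite leq_add2r ltnW.
Qed.

(** Away from glitches a visit happens while some [z t] is followed. For [h] large this is possible
    only if [y] lies in the orbit closure of that [z t], and [z_sep] leaves at most one such [t]; if
    there is none, all visits are near glitches, against positivity. *)
Lemma visit_pos Q y : (forall h, pos Q (V h y)) ->
  exists t, [/\ (t < 3)%N, orbit_closure t y & pos Q (fun i => typ i == t)].
Proof.
move=> H.
have far t : (t < 3)%N -> ~ orbit_closure t y -> exists h, forall h', (h <= h')%N ->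
    forall m, ~ agree h' y (shiftn m (z t)).
  move=> t3 /existsNP[h /forallNP Hh]; exists h => h' hh m Hm; apply: (Hh m).
  exact: agreeS Hm.
have VB h i : V h y i -> ~~ nearby glitch h i ->
    agree h y (shiftn (red i + bit pr (st (red i))) (z (typ i))).
  by move=> /asboolP h1 ng; apply: agree_trans h1 _; exact: point_run.
have zB h := @zero_banach_nearby _ h (glitch_zero_banach c2).
have [[s [s3 ys]]|no] := pselect (exists s, (s < 3)%N /\ orbit_closure s y).
  exists s; split => //.
  have far' t : exists h, forall h', (h <= h')%N -> (t < 3)%N -> t != s ->
      forall m, ~ agree h' y (shiftn m (z t)).
    have [t3|t3] := boolP (t < 3)%N; last by exists 0%N.
    have [->|ts] := eqVneq t s; first by exists 0%N.
    have [|h Hh] := far _ t3; last by exists h => h' hh _ _; exact: Hh.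
    by move=> yt; move/eqP: ts; apply; exact: z_sep yt ys.
  have [h0 H0] := far' 0%N; have [h1 H1] := far' 1%N; have [h2 H2] := far' 2%N.
  pose h := (h0 + h1 + h2)%N.
  apply: (@pos_zero_banach_sub _ _ _ _ 1 0 (zB h)) (H h) => n m.
  rewrite mul1n addn0; apply: leq_trans (cntU _ _ _ _); apply: cnt_sub => i _ _ Vi.
  apply/orP; have [|ng] := boolP (nearby glitch h i); first by right.
  left; apply: contraT => ts; have := VB _ _ Vi ng; have := typ_lt3 i.
  move: ts; rewrite -/(typ i); move: (typ i) => [|[|[|//]]] ts t3 a; exfalso.
  - by apply: (H0 h) a; rewrite // /h -addnA leq_addr.
  - by apply: (H1 h) a; rewrite // /h addnAC leq_addl.
  - by apply: (H2 h) a; rewrite // /h leq_addl.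
have [h0 H0] : exists h, forall h', (h <= h')%N -> forall m, ~ agree h' y (shiftn m (z 0)).
  by apply: far => // ?; apply: no; exists 0%N.
have [h1 H1] : exists h, forall h', (h <= h')%N -> forall m, ~ agree h' y (shiftn m (z 1)).
  by apply: far => // ?; apply: no; exists 1%N.
have [h2 H2] : exists h, forall h', (h <= h')%N -> forall m, ~ agree h' y (shiftn m (z 2)).
  by apply: far => // ?; apply: no; exists 2%N.
pose h := (h0 + h1 + h2)%N.
exfalso; apply: (@not_pos_zero_banach Q _ (zB h)).
apply: (@pos_sub _ _ _ 1 0 0) (H h) => n m _; rewrite mul1n addn0.
apply: cnt_sub => i _ _ Vi; apply: contraT => ng; exfalso.
have := VB _ _ Vi ng; have := typ_lt3 i.
move: (typ i) => [|[|[|//]]] t3 a.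
- by apply: (H0 h) a; rewrite // /h -addnA leq_addr.
- by apply: (H1 h) a; rewrite // /h addnAC leq_addl.
- by apply: (H2 h) a; rewrite // /h leq_addl.
Qed.

Lemma omega_point Q y : omega_dens (@dens_of R Q) x y <->
  exists t, [/\ (t < 3)%N, orbit_closure t y & pos Q (fun i => typ i == t)].
Proof.
rewrite omega_densP; split; first exact: visit_pos.
by move=> [t [t3 yt H]] h; exact: pos_visit H.
Qed.

Lemma orbit_closure_self t : orbit_closure t (z t).
Proof. by move=> h; exists 0%N. Qed.

Lemma point_return h n0 : exists n, (n0 <= n)%N /\ agree h x (shiftn n x).
Proof.
pose j := (h + n0)%N; exists (stg j.+1).
have j1 : (j <= stg j)%N.
  have := pow2_leq_stg c2 j; have := ltn_expl j (ltnSn 1); lia.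
have j2 := stgS_big c2 j; split; first by rewrite /j in j1 j2 *; lia.
apply: (@agreeS _ _ (stg j)); first by rewrite /j in j1 *; lia.
move=> i ij; rewrite /shiftn /point; congr basept; symmetry.
have si : st (stg j.+1 + i) = j.+1.
  by apply: st_eq; [exact: leq_addr|have := stgS_big c2 j.+1; lia].
by rewrite red_copied ?si ?addKn// copiedE si /= ltn_add2l.
Qed.

Lemma point_Rec : Rec R x.
Proof.
move=> e e0; have [h Hh] := ball_agree x e0; have [n [n1 Hn]] := point_return h 1.
by exists n; split => //; apply/Hh/agree_sym.
Qed.

Lemma point_omega_lim : omega_lim R x x.
Proof.
move=> e N e0; have [h Hh] := ball_agree x e0; have [n [n1 Hn]] := point_return h N.
by exists n => //; apply/Hh/agree_sym.
Qed.

Lemma omega_proper Q Q' : 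
  (forall t, pos Q (fun i => typ i == t) -> pos Q' (fun i => typ i == t)) ->
  (exists t, [/\ (t < 3)%N, pos Q' (fun i => typ i == t) & ~ pos Q (fun i => typ i == t)]) ->
  Defs.proper_sub (omega_dens (@dens_of R Q) x) (omega_dens (@dens_of R Q') x).
Proof.
move=> sub [t [t3 p np]]; split.
  by move=> y /omega_point[s [s3 ys /sub ps]]; apply/omega_point; exists s.
move=> e; have : omega_dens (@dens_of R Q') x (z t).
  by apply/omega_point; exists t; split => //; exact: orbit_closure_self.
rewrite -e => /omega_point[s [s3 zs ps]].
by apply: np; rewrite (z_sep t3 s3 (@orbit_closure_self t) zs).
Qed.

Lemma omega_eq Q Q' : 
  (forall t, pos Q (fun i => typ i == t) <-> pos Q' (fun i => typ i == t)) ->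
  omega_dens (@dens_of R Q) x = omega_dens (@dens_of R Q') x.
Proof.
move=> E; apply/seteqP; split => y /omega_point[s [s3 ys ps]]; apply/omega_point;
  by exists s; split => //; apply/E.
Qed.

Hypothesis w_le : (w <= stg 0)%N.
Hypothesis junk : forall t m, (t < 3)%N -> ~ agree w U (shiftn m (z t)).

Lemma point_junk : agree w x U.
Proof.
move=> i iw; have i0 : (i < stg 0)%N by exact: leq_trans w_le.
rewrite /point red_id /basept ?i0//; apply/negP => /andP[s0 _].
have := st_gt0_ge s0; have := leq_stg c (leq0n (st i)); lia.
Qed.

Lemma point_notin t : (t < 3)%N -> ~ orbit_closure t x.
Proof.
move=> t3 /(_ w)[m H]; apply: (@junk t m t3).
by apply: agree_trans H; exact/agree_sym/point_junk.
Qed.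

(** Banach recurrence would put the point into its own upper Banach limit set, hence into some orbit
    closure; its first [w] letters forbid that. *)
Lemma point_nBR : ~ BR R x.
Proof.
move=> H; have /omega_point[t [t3 /(point_notin t3)]] : omega_dens (@dens_of R UpperB) x x by [].
by [].
Qed.

(** The point itself separates the two sets. For the inclusion, visits that all occur before [N]
    number at most [N] in any window. *)
Lemma omega_UB_lim : Defs.proper_sub (omega_dens (@dens_of R UpperB) x) (omega_lim R x).
Proof.
split; last by move=> e; apply: point_nBR; have := point_omega_lim; rewrite -e.
move=> y /omega_densP H e N e0; have [h Hh] := ball_agree y e0.
apply: contrapT => no; have [K HK] := H h.
have [n [m [n1]]] := HK (K * N).+1.
apply/negP; rewrite -ltnNge; apply: leq_ltn_trans n1.
rewrite leq_mul2l; apply/orP; right.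
apply: leq_trans (_ : cnt (fun i => (i < N)%N) m n <= _)%N; last first.
  by apply: leq_trans (cnt_ltn _ _ _) _; exact: leq_subr.
apply: cnt_sub => i _ _ /asboolP Hi; rewrite ltnNge; apply/negP => Ni.
by apply: no; exists i => //; apply/Hh/agree_sym.
Qed.

End Point.
(* The limit densities of the types 0 and 1 are [thr b / 4] and           *)
(* [1 - thr b / 4] at the ends of the stages of parity [b].               *)
Definition case_thr (i : nat) (b : bool) : nat :=
  if b then if (i == 3) || (i == 5) then 0 else 1 else if (i <= 2)%N then 3 else 4.

(* Type 2 only occurs on the sparse initial runs of the stages: it has    *)
(* zero density and positive upper Banach density.                        *)
Definition case_ext (i : nat) : nat := if i \in [:: 2; 5; 6]%N then 2 else 0.

Lemma case_thr_le4 i b : (case_thr i b <= 4)%N.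
Proof. by rewrite /case_thr; case: b; case: ifP. Qed.

Lemma case_thr_false i : (0 < case_thr i false)%N.
Proof. by rewrite /case_thr; case: ifP. Qed.

Lemma case_thr_true i : (case_thr i true < 4)%N.
Proof. by rewrite /case_thr; case: ifP. Qed.

Lemma case_ext02 i : case_ext i = 0%N \/ case_ext i = 2%N.
Proof. by rewrite /case_ext; case: ifP; [right|left]. Qed.

Section Cases.
Variables (R : realType) (k : nat).
Variables (z : nat -> Sigma k) (U : Sigma k) (w c : nat).
Hypothesis c2 : (2 <= c)%N.
Hypothesis w_le : (w <= stg c 0)%N.
Hypothesis z_rec : forall t, (t < 3)%N -> forall h, exists K, forall m,
  exists i, (i < K)%N /\ agree h (z t) (shiftn (m + i) (z t)).
Hypothesis z_sep : forall s t y, (s < 3)%N -> (t < 3)%N ->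
  orbit_closure z s y -> orbit_closure z t y -> s = t.
Hypothesis junk : forall t m, (t < 3)%N -> ~ agree w U (shiftn m (z t)).

(** No type is positive for [LowerB]. Types 0 and 1 have positive lower density in cases 1 and 2,
    type 0 alone in cases 4 and 6, neither in cases 3 and 5. Both always have positive upper
    density, and cases 2, 5 and 6 add type 2 for the upper Banach density. *)
Lemma case_point i pr : (1 <= i <= 6)%N ->
  case_prop R i (point z U c2 (case_thr i) (case_ext i) pr).
Proof.
move=> i16; set thr := case_thr i; set ext := case_ext i; set x := point _ _ _ _ _ _.
have F := case_thr_false i; have T := case_thr_true i; have E := case_ext02 i.
pose P Q t := pos Q (fun n => typ c2 thr ext n == t).
have LB t : ~ P LowerB t.
  exact: (@typ_pos_LB c c2 thr ext F T t).
have L t : P LowerD t <-> (t < 2)%N /\ forall b, (0 < wt thr t b)%N.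
  exact: (typ_pos_L c2 ext (@case_thr_le4 i)).
have D t : P UpperD t <-> (t < 2)%N /\ exists b, (0 < wt thr t b)%N.
  exact: (typ_pos_U c2 ext (@case_thr_le4 i) F T).
have B t : P UpperB t <-> (t < 2)%N \/ t = ext.
  exact: (typ_pos_UB c2 ext (@case_thr_le4 i) F T).
have prop Q Q' : (forall t, P Q t -> P Q' t) ->
   (exists t, [/\ (t < 3)%N, P Q' t & ~ P Q t]) ->
   Defs.proper_sub (omega_dens (@dens_of R Q) x) (omega_dens (@dens_of R Q') x).
  exact: (omega_proper R U E z_rec z_sep).
have eqo Q Q' : (forall t, P Q t <-> P Q' t) ->
   omega_dens (@dens_of R Q) x = omega_dens (@dens_of R Q') x.
  exact: (omega_eq R U E z_rec z_sep).
have ext3 : (ext < 3)%N by rewrite /ext; case: (case_ext02 i) => ->.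
have last_ : Defs.proper_sub (omega_dens (@dens_of R UpperB) x) (omega_lim R x).
  exact: (omega_UB_lim R c2 thr E z_rec z_sep pr w_le junk).
have LU t := @pos_L_U (fun n => typ c2 thr ext n == t).
have UB t := @pos_U_UB (fun n => typ c2 thr ext n == t).
have b01 : forall b t, (t < 2)%N -> thr true != 0%N -> thr false != 4%N -> (0 < wt thr t b)%N.
  by rewrite /thr /case_thr => -[] [|[|//]] _; rewrite /wt /case_thr; case: ifP => //; case: ifP.
have LBproper t : (t < 3)%N -> P LowerD t ->
    Defs.proper_sub (omega_dens (@dens_of R LowerB) x) (omega_dens (@dens_of R LowerD) x).
  by move=> t3 Lt; apply: prop; [by move=> s /LB|exists t; split => //; exact: LB].
have D01 t : P UpperD t <-> (t < 2)%N.
  rewrite D; split=> [[]//|t2]; split => //.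
  move: t t2 => [|[|//]] _; first by exists false; exact: case_thr_false.
  by exists true; rewrite /wt /= subn_gt0; exact: case_thr_true.
have DB : ext = 0%N -> omega_dens (@dens_of R UpperD) x = omega_dens (@dens_of R UpperB) x.
  move=> e0; apply: eqo => t; rewrite D01 B e0.
  by split=> [|[|->]]; [left| |].
have DBp : ext = 2%N -> Defs.proper_sub (omega_dens (@dens_of R UpperD) x) (omega_dens (@dens_of R UpperB) x).
  move=> e2; apply: prop; first exact: UB.
  by exists 2%N; split => //; [apply/B; right|move/D01].
have LDp : ~ P LowerD 1 -> Defs.proper_sub (omega_dens (@dens_of R LowerD) x) (omega_dens (@dens_of R UpperD) x).
  move=> n1; apply: prop; first exact: LU.
  by exists 1%N; split => //; apply/D01.
have i_cases : i = 1%N \/ i = 2%N \/ i = 3%N \/ i = 4%N \/ i = 5%N \/ i = 6%N by lia.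
have L3 : thr true = 1%N -> P LowerD 0%N.
  move=> e; apply/L; split => // -[]; rewrite /wt eqxx ?e//; exact: F.
have L0 : thr true = 0%N -> thr false = 4%N ->
    omega_dens (@dens_of R LowerB) x = omega_dens (@dens_of R LowerD) x.
  move=> e0 e4; apply: eqo => t; split; first by move/LB.
  move/L => [t2 H]; move: t t2 H => [|[|//]] _ H.
    by have := H true; rewrite /wt eqxx e0.
  by have := H false; rewrite /wt e4.
have nL1 : thr false = 4%N -> ~ P LowerD 1%N.
  by move=> e4 /L[_ /(_ false)]; rewrite /wt e4.
have LDe : thr true = 1%N -> thr false = 3%N ->
    omega_dens (@dens_of R LowerD) x = omega_dens (@dens_of R UpperD) x.
  move=> e1 e3; apply: eqo => t; rewrite D01; split; first by move/L => [].
  by move=> t2; apply/L; split => // b; apply: b01; rewrite ?e1 ?e3.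
have thrE b : thr b = case_thr i b by [].
have extE : ext = case_ext i by [].
clearbody thr ext; rewrite /case_prop.
move: i_cases => [|[|[|[|[|]]]]] ei; move: thrE extE; rewrite ei => thrE extE.
- by split; [exact: (@LBproper 0%N isT (L3 (thrE true)))|exact: LDe (thrE true) (thrE false)|exact: DB extE|exact: last_].
- by split; [exact: (@LBproper 0%N isT (L3 (thrE true)))|exact: LDe (thrE true) (thrE false)|exact: DBp extE|exact: last_].
- by split; [exact: L0 (thrE true) (thrE false)|exact: (LDp (nL1 (thrE false)))|exact: DB extE|exact: last_].
- by split; [exact: (@LBproper 0%N isT (L3 (thrE true)))|exact: (LDp (nL1 (thrE false)))|exact: DB extE|exact: last_].
- by split; [exact: L0 (thrE true) (thrE false)|exact: (LDp (nL1 (thrE false)))|exact: DBp extE|exact: last_].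
- by split; [exact: (@LBproper 0%N isT (L3 (thrE true)))|exact: (LDp (nL1 (thrE false)))|exact: DBp extE|exact: last_].
Qed.

End Cases.
(** * Birkhoff averages of the points *)

Section Averages.
Variables (R : realType) (k : nat) (phi : Sigma k -> R).
Hypothesis hphi : d_continuous phi.
Notation BS := (birk_sum phi).
Variables (z : nat -> Sigma k) (U : Sigma k) (c : nat).
Hypothesis c2 : (2 <= c)%N.
Variables (thr : bool -> nat) (ext : nat).
Hypothesis thr_le4 : forall b, (thr b <= 4)%N.
Hypothesis ext02 : ext = 0%N \/ ext = 2%N.
Variable a_ : nat -> R.
Hypothesis z_avg : forall t, (t < 3)%N -> forall d : R, 0 < d -> exists N, forall n,
  (N <= n)%N -> forall m, `|BS (shiftn m (z t)) n - a_ t * n%:R| <= d * n%:R.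

Local Notation glitch := (glitch c2).
Local Notation typ := (typ c2 thr ext).
Local Notation stg := (stg c).

Variable pr : nat -> bool.
Local Notation x := (point z U c2 thr ext pr).

Lemma birk_sum_shift (y : Sigma k) (C : R) : (forall u, `|phi u| <= C) ->
  forall n l, `|BS (shiftn l y) n - BS y n| <= 2 * C * l%:R.
Proof.
move=> HC n l; have e1 := BSD phi y l n; have e2 := BSD phi y n l.
have H u : `|BS u l| <= C * l%:R.
  rewrite /birk_sum; apply: le_trans (ler_norm_sum _ _ _) _.
  apply: (@le_trans _ _ (\sum_(i < l) C)); first by apply: ler_sum => i _.
  by rewrite sumr_const card_ord mulr_natr.
have -> : BS (shiftn l y) n - BS y n = BS (shiftn n y) l - BS y l.
  by rewrite addnC e2 in e1; lra.
apply: le_trans (ler_normB _ _) _; have := H y; have := H (shiftn n y); lra.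
Qed.

(* Summing the length-H averages over a window recovers the window average *)
(* up to a boundary term independent of the window.                        *)
Lemma birk_sum_average (y : Sigma k) (C : R) : (forall u, `|phi u| <= C) ->
  forall n H, `|\sum_(i < n) BS (shiftn i y) H - H%:R * BS y n| <= 2 * C * H%:R * H%:R.
Proof.
move=> HC n H.
have -> : \sum_(i < n) BS (shiftn i y) H = \sum_(l < H) BS (shiftn l y) n.
  rewrite /birk_sum exchange_big /=; apply: eq_bigr => l _; apply: eq_bigr => i _.
  by rewrite !shiftnD addnC.
have -> : H%:R * BS y n = \sum_(l < H) BS y n by rewrite sumr_const card_ord mulr_natl.
rewrite -sumrB; apply: le_trans (ler_norm_sum _ _ _) _.
have C0 : 0 <= C by exact: le_trans (normr_ge0 _) (HC y).
apply: (@le_trans _ _ (\sum_(l < H) (2 * C * H%:R))).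
  apply: ler_sum => l _; apply: le_trans (birk_sum_shift _ HC _ _) _.
  by rewrite ler_wpM2l ?mulr_ge0// ler_nat ltnW.
by rewrite sumr_const card_ord -[X in X <= _]mulr_natr.
Qed.

(** Sums over windows of a fixed length [H] are compared: away from glitches the point follows
    [z (typ i)] for [H] steps, windows meeting a glitch are rare, and [birk_sum_average] leads back
    to the sum itself. *)
Lemma birk_point (e : R) : 0 < e -> exists n0, forall n, (n0 <= n)%N ->
  `|BS x n - \sum_(i < n) a_ (typ i)| <= e * n%:R.
Proof.
move=> e0; have e8 : 0 < e / 8 by rewrite divr_gt0.
have [C [C0 HC]] := phi_bounded hphi.
have [D [D0 HD]] := BS_distortion hphi e8.
have [N HN] : exists N, forall t, (t < 3)%N -> forall n, (N <= n)%N -> forall m,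
    `|BS (shiftn m (z t)) n - a_ t * n%:R| <= e / 8 * n%:R.
  have [N0 H0] := z_avg (isT : (0 < 3)%N) e8.
  have [N1 H1] := z_avg (isT : (1 < 3)%N) e8.
  have [N2 H2] := z_avg (isT : (2 < 3)%N) e8.
  exists (N0 + N1 + N2)%N => -[|[|[|//]]] _ n nn.
  - by apply: H0; apply: leq_trans nn; rewrite -addnA leq_addr.
  - by apply: H1; apply: leq_trans nn; rewrite addnAC leq_addl.
  - by apply: H2; apply: leq_trans nn; rewrite leq_addl.
pose M := `|a_ 0%N| + `|a_ 1%N| + `|a_ 2%N|.
have M0 : 0 <= M by rewrite !addr_ge0.
have HM i : `|a_ (typ i)| <= M.
  have n0 := normr_ge0 (a_ 0%N); have n1 := normr_ge0 (a_ 1%N); have n2 := normr_ge0 (a_ 2%N).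
  have := typ_lt3 c2 thr ext02 i; case: (typ i) => [|[|[|//]]] _; rewrite /M; lra.
pose H := ((N + Num.truncn (D / (e / 8))).+1)%N.
have NH : (N <= H)%N by rewrite /H leqW// leq_addr.
have DH : D <= e / 8 * H%:R.
  rewrite -ler_pdivrMl// mulrC; apply: le_trans (ltW (truncnS_gt _)) _.
  by rewrite ler_nat /H ltnS leq_addl.
have H0 : 0 < H%:R :> R by rewrite ltr0n.
pose B := nearby glitch H.
have HB i : `|BS (shiftn i x) H - a_ (typ i) * H%:R| <= 3 * (e / 8) * H%:R + (C + M) * H%:R * (B i)%:R.
  have [Bi|nB] := boolP (B i).
    rewrite mulr1; apply: le_trans (_ : (C + M) * H%:R <= _); last first.
      by rewrite lerDr mulr_ge0// ?ltW// mulr_gt0.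
    apply: le_trans (ler_normB _ _) _; rewrite mulrDl lerD//.
      rewrite /birk_sum; apply: le_trans (ler_norm_sum _ _ _) _.
      apply: (@le_trans _ _ (\sum_(i < H) C)); first by apply: ler_sum => j _.
      by rewrite sumr_const card_ord mulr_natr.
    by rewrite normrM normr_nat ler_wpM2r.
  rewrite mulr0 addr0; set m := (red c2 i + bit pr (st c2 (red c2 i)))%N.
  have h1 : `|BS (shiftn i x) H - BS (shiftn m (z (typ i))) H| <= e / 8 * H%:R + D.
    by apply: HD; exact: point_run nB.
  have := HN _ (typ_lt3 c2 thr ext02 i) _ NH m.
  move: h1; rewrite !ler_norml => /andP[? ?] /andP[? ?]; apply/andP; split; lra.
have [K HK] : exists K : nat, C + M <= e / 8 * K%:R.
  exists (Num.truncn ((C + M) / (e / 8))).+1.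
  by rewrite -ler_pdivrMl// mulrC ltW// truncnS_gt.
have [n1 Hn1] := @zero_banach_nearby _ H (glitch_zero_banach c2) K.
pose n2 := (Num.truncn (2 * C * H%:R / (e / 8))).+1.
exists (n1 + n2)%N => n nn.
have h1 : (C + M) * (cnt B 0 n)%:R <= e / 8 * n%:R.
  apply: (@le_trans _ _ (e / 8 * K%:R * (cnt B 0 n)%:R)); first by rewrite ler_wpM2r.
  rewrite -mulrA ler_pM2l// -natrM ler_nat; apply: Hn1.
  by apply: leq_trans nn; exact: leq_addr.
have h2 : 2 * C * H%:R <= e / 8 * n%:R.
  rewrite -ler_pdivrMl// mulrC; apply: le_trans (ltW (truncnS_gt _)) _.
  by rewrite ler_nat; apply: leq_trans nn; exact: leq_addl.
have h3 := birk_sum_average x HC n H.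
have h4 : `|\sum_(i < n) BS (shiftn i x) H - H%:R * \sum_(i < n) a_ (typ i)| <=
    3 * (e / 8) * H%:R * n%:R + (C + M) * H%:R * (cnt B 0 n)%:R.
  rewrite mulr_sumr -sumrB; apply: le_trans (ler_norm_sum _ _ _) _.
  apply: (@le_trans _ _ (\sum_(i < n) (3 * (e / 8) * H%:R + (C + M) * H%:R * (B i)%:R))).
    by apply: ler_sum => i _; rewrite [H%:R * _]mulrC.
  by rewrite big_split /= sumr_const card_ord -[X in X + _ <= _]mulr_natr -mulr_sumr /cnt natr_sum.
have h5 : (C + M) * H%:R * (cnt B 0 n)%:R <= e / 8 * n%:R * H%:R.
  by rewrite mulrAC ler_pM2r.
have h6 : 2 * C * H%:R * H%:R <= e / 8 * n%:R * H%:R by rewrite ler_pM2r.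
set X := BS x n in h3 *; set T := \sum_(i < n) BS _ _ in h3 h4; set A := \sum_(i < n) _ in h4 *.
rewrite -(ler_pM2l H0) -{1}[H%:R]gtr0_norm// -normrM mulrBr.
have en0 : 0 <= e * n%:R * H%:R by rewrite !mulr_ge0// ltW.
have E1 : 3 * (e / 8) * H%:R * n%:R = 3 / 8 * (e * n%:R * H%:R) by field.
have E2 : e / 8 * n%:R * H%:R = 1 / 8 * (e * n%:R * H%:R) by field.
have E3 : H%:R * (e * n%:R) = e * n%:R * H%:R by ring.
rewrite E1 in h4; rewrite E2 in h5 h6; rewrite E3.
move: h3 h4; set HX := H%:R * X; set HA := H%:R * A.
rewrite !ler_norml => /andP[? ?] /andP[? ?]; apply/andP; split; lra.
Qed.

Lemma birkhoffE n : birkhoff phi x n = n%:R^-1 * BS x n.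
Proof. by []. Qed.

Lemma point_R_phi a : (forall t, (t < 3)%N -> a_ t = a) -> R_phi_a phi a x.
Proof.
move=> Ha; apply/cvgrPdist_le => e e0; have [n0 Hn0] := birk_point e0.
exists n0.+1 => // n /= nn; have n_gt0 : 0 < n%:R :> R by rewrite ltr0n (leq_trans _ nn).
have := Hn0 n (ltnW nn).
have -> : \sum_(i < n) a_ (typ i) = a * n%:R.
  under eq_bigr => i _ do rewrite Ha ?typ_lt3//.
  by rewrite sumr_const card_ord mulr_natr.
rewrite birkhoffE => h; rewrite -(ler_pM2r n_gt0) distrC.
rewrite -{2}[n%:R]gtr0_norm// -normrM mulrBl mulrAC mulVf ?gt_eqF// mul1r.
exact: h.
Qed.

(** Since types 0 and 2 share their average, only the count of type 1 matters. At the ends of the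
    stages of parity [b] the average approaches [a_ 0 + (a_ 1 - a_ 0) * wt thr 1 b / 4], and the two
    parities have different weights. *)
Lemma point_I_phi : a_ 0%N <> a_ 1%N -> a_ 2%N = a_ 0%N -> thr true <> thr false ->
  I_phi phi x.
Proof.
move=> a01 a02 thr_ne [l Hl].
pose d := `|a_ 1%N - a_ 0%N|.
have d0 : 0 < d by rewrite normr_gt0 subr_eq0; apply/eqP => e; apply: a01.
have d64 : 0 < d / 64 by rewrite divr_gt0.
have [n0 Hn0] := birk_point d64.
have /cvgrPdist_le/(_ _ d64)[n1 _ Hn1] := Hl.
have key b : `|4 * (l - a_ 0%N) - (a_ 1%N - a_ 0%N) * (wt thr 1 b)%:R| <= d / 4.
  pose j := (2 * (n0 + n1).+4 + b)%N.
  have j16 : (16 <= 2 ^ j)%N.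
    by rewrite -[16%N]/(2 ^ 4)%N leq_exp2l// /j; lia.
  have jb : odd j = b by rewrite /j oddD mul2n odd_double; case: (b).
  have j0 : (0 < j)%N by rewrite /j; lia.
  have jn : (n0 + n1 <= j)%N by rewrite /j; lia.
  clearbody j.
  have [t1 t2] := typ_stage c2 ext thr_le4 (isT : (1 < 2)%N) j0.
  rewrite jb in t1 t2; set n := stg j.+1 in t1 t2; set q := cnt _ _ _ in t1 t2.
  have nj : (n0 + n1 < n)%N.
    have := pow2_leq_stg c2 j.+1; have := ltn_expl j.+1 (ltnSn 1); rewrite -/n; lia.
  have n_gt0 : 0 < n%:R :> R by rewrite ltr0n stg_gt0.
  have hs : \sum_(i < n) a_ (typ i) = a_ 0%N * n%:R + (a_ 1%N - a_ 0%N) * q%:R.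
    rewrite (eq_bigr (fun i : 'I_n => a_ 0%N + (a_ 1%N - a_ 0%N) * (typ i == 1%N)%:R)).
      by rewrite big_split /= sumr_const card_ord -mulr_sumr -[a_ 0%N *+ n]mulr_natr /q /cnt natr_sum.
    move=> i _; have := typ_lt3 c2 thr ext02 i.
    by case: (typ i) => [|[|[|//]]] _ /=; rewrite ?a02; ring.
  have h1 : `|BS x n - l * n%:R| <= d / 64 * n%:R.
    have := Hn1 n; rewrite /= => /(_ _)/wrap[]; first by lia.
    rewrite birkhoffE => h; have : `|l - n%:R^-1 * BS x n| * n%:R <= d / 64 * n%:R by rewrite ler_pM2r.
    by rewrite -{2}[n%:R]gtr0_norm// -normrM mulrBl mulrAC mulVf ?gt_eqF// mul1r distrC.
  have h2 : `|BS x n - (a_ 0%N * n%:R + (a_ 1%N - a_ 0%N) * q%:R)| <= d / 64 * n%:R.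
    by rewrite -hs; apply: Hn0; lia.
  have h3 : `|4 * q%:R - (wt thr 1 b)%:R * n%:R| <= n%:R / 16 :> R.
    have p0 : 0 < (2 ^ j)%:R :> R by rewrite ltr0n expn_gt0.
    have p16 : 16 <= (2 ^ j)%:R :> R by rewrite (ler_nat R 16).
    have r1 : (2 ^ j)%:R * (4 * q%:R) <= ((2 ^ j)%:R * (wt thr 1 b)%:R + 1) * n%:R :> R.
      by move: t1; rewrite -(ler_nat R) !natrM natrD natrM.
    have r2 : (2 ^ j)%:R * (wt thr 1 b)%:R * n%:R <= (2 ^ j)%:R * (4 * q%:R) + n%:R :> R.
      by move: t2; rewrite -(ler_nat R) natrD !natrM.
    have r3 : n%:R <= (2 ^ j)%:R * (n%:R / 16) :> R.
      have : 16 * (n%:R / 16) <= (2 ^ j)%:R * (n%:R / 16) :> R.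
        by rewrite ler_pM2r// divr_gt0.
      lra.
    rewrite ler_norml; apply/andP; split; rewrite -(ler_pM2l p0); nra.
  have h4 : `|(a_ 1%N - a_ 0%N) * (4 * q%:R - (wt thr 1 b)%:R * n%:R)| <= d * (n%:R / 16).
    by rewrite normrM ler_wpM2l.
  rewrite -(ler_pM2r n_gt0) -{1}[n%:R]gtr0_norm// -normrM.
  have -> : (4 * (l - a_ 0%N) - (a_ 1%N - a_ 0%N) * (wt thr 1 b)%:R) * n%:R =
     4 * (BS x n - (a_ 0%N * n%:R + (a_ 1%N - a_ 0%N) * q%:R)) - 4 * (BS x n - l * n%:R)
      + (a_ 1%N - a_ 0%N) * (4 * q%:R - (wt thr 1 b)%:R * n%:R) by ring.
  move: h1 h2 h4; set v1 := BS x n - l * n%:R; set v2 := BS x n - (_ + _); set v3 := _ * (_ - _).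
  rewrite !ler_norml => /andP[? ?] /andP[? ?] /andP[? ?]; apply/andP; split; lra.
have k1 := key true; have k2 := key false.
have : `|(a_ 1%N - a_ 0%N) * ((wt thr 1 true)%:R - (wt thr 1 false)%:R)| <= d / 2.
  have -> : (a_ 1%N - a_ 0%N) * ((wt thr 1 true)%:R - (wt thr 1 false)%:R) =
    (4 * (l - a_ 0%N) - (a_ 1%N - a_ 0%N) * (wt thr 1 false)%:R) -
    (4 * (l - a_ 0%N) - (a_ 1%N - a_ 0%N) * (wt thr 1 true)%:R) by ring.
  apply: le_trans (ler_normB _ _) _; lra.
rewrite normrM -/d => h.
have : 1 <= `|(wt thr 1 true)%:R - (wt thr 1 false)%:R| :> R.
  have := thr_le4 true; have := thr_le4 false; rewrite /wt /= => l1 l2.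
  have nd (p q : nat) : (p < q)%N -> 1 <= `|p%:R - q%:R| :> R.
    move=> pq; rewrite distrC; apply: le_trans (ler_norm _).
    by rewrite -natrB ?(ltnW pq)// ler1n subn_gt0.
  have : (4 - thr true != 4 - thr false)%N by apply/eqP => e; apply: thr_ne; lia.
  by rewrite neq_ltn => /orP[/nd//|/nd]; rewrite distrC.
nra.
Qed.

End Averages.
(** * Distributional chaos *)

Section LimitCriteria.
Variable R : realType.

Lemma limn_einf_eq0 (u : nat -> R) : (forall n, 0 <= u n) ->
  (forall (e : R) n0, 0 < e -> exists n, (n0 <= n)%N /\ u n <= e) ->
  limn_einf (fun n => (u n)%:E) = 0%E.
Proof.
move=> u0 H; apply/eqP; rewrite eq_le; apply/andP; split.
  rewrite leNgt; apply/negP => /limn_einf_gt0[e [e0 [n0 He]]].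
  have [n [nn un]] := H (e / 2) n0 (divr_gt0 e0 (ltr0Sn R 1)).
  have := He n nn; rewrite lee_fin; lra.
rewrite limn_einf_lim (cvg_lim _ (@cvg_einfs_sup R (fun n => (u n)%:E)))//.
apply: (@le_trans _ _ (einfs (fun n => (u n)%:E) 0%N)); last by apply: ereal_sup_ubound; exists 0%N.
by apply: le_ereal_inf_tmp => _ [n _ <-]; rewrite lee_fin.
Qed.

Lemma limn_esup_eq1 (u : nat -> R) : (forall n, u n <= 1) ->
  (forall (e : R) n0, 0 < e -> exists n, (n0 <= n)%N /\ 1 - u n <= e) ->
  limn_esup (fun n => (u n)%:E) = 1%E.
Proof.
move=> u1 H; have E : limn_einf (fun n => (1 - u n)%:E) = 0%E.
  by apply: limn_einf_eq0 => // n; rewrite subr_ge0.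
have := @limn_einf_shift R (fun n => (- u n)%:E) 1%E isT.
have -> : limn_einf (fun n => (- u n)%:E) = (- limn_esup (fun n => (u n)%:E))%E.
  by rewrite -limn_einfN.
rewrite [X in X = _](_ : _ = 0%E); last by rewrite -E.
case: limn_esup => [r| |]//= -[] h.
by congr (_%:E); lra.
Qed.

Variable k : nat.

Lemma close_freqE (x y : Sigma k) (s : R) n : close_freq x y s n =
  n%:R^-1 * (cnt (fun i => dist R (shiftn i x) (shiftn i y) < s) 0 n)%:R.
Proof.
rewrite /close_freq /cnt natr_sum; congr (_ * _); apply: eq_bigr => i _.
by rewrite add0n; case: ifP.
Qed.

Lemma close_freq_ge0 (x y : Sigma k) (s : R) n : 0 <= close_freq x y s n.
Proof. by rewrite close_freqE mulr_ge0. Qed.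

Lemma close_freq_le1 (x y : Sigma k) (s : R) n : close_freq x y s n <= 1.
Proof.
rewrite close_freqE; case: n => [|n]; first by rewrite cnt0 mulr0.
by rewrite ler_pdivrMl ?ltr0n// mulr1 ler_nat cnt_le.
Qed.

Lemma DC1_pair_neq (x y : Sigma k) : DC1_pair R x y -> x <> y.
Proof.
move=> [[s s0 H] _] xy; move: H; rewrite xy.
have E : forall n, (0 < n)%N -> close_freq y y s n = 1.
  move=> n n0; rewrite close_freqE cnt_predT ?mulVf ?pnatr_eq0 ?gtn_eqF// => i _ _.
  have [h hs] := exists_pow_lt s0; apply: le_lt_trans hs; exact: dist_le.
move=> H; have : (0 < limn_einf (fun n => (close_freq y y s n)%:E))%E.
  by apply/limn_einf_gt0; exists 1; split => //; exists 1%N => n n0; rewrite E.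
by rewrite H ltxx.
Qed.

End LimitCriteria.

Section Scrambled.
Variables (R : realType) (k : nat).
Variables (z : nat -> Sigma k) (U : Sigma k) (c : nat).
Hypothesis c2 : (2 <= c)%N.
Variables (thr : bool -> nat) (ext : nat).
Hypothesis ext02 : ext = 0%N \/ ext = 2%N.
Hypothesis z_nonconst : forall t, (t < 3)%N -> exists H, forall m,
  exists l, (l < H)%N /\ z t (m + l)%N <> z t (m + l).+1.

Local Notation stg := (stg c).
Local Notation st := (st c2).
Local Notation copied := (copied c2).
Local Notation glitch := (glitch c2).
Local Notation point := (point z U c2 thr ext).

Lemma late_stage j i : (0 < j)%N -> (2 * stg j <= i)%N -> (i < stg j.+1)%N ->
  st i = j /\ ~~ copied i.
Proof.
move=> j0 h1 h2; have si : st i = j by apply: st_eq => //; lia.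
by rewrite copiedE si negb_and -!leqNgt; split => //; have := leq_stg c (leq_pred j); lia.
Qed.

(** In a stage reading bit [r] one point follows [z t] from [i] and the other from [i.+1], with the
    same [t]; the sequence differs from its shift within [H] steps. *)
Lemma point_differ pr pr' r j H i : (forall t, (t < 3)%N -> forall m,
    exists l, (l < H)%N /\ z t (m + l)%N <> z t (m + l).+1) ->
  pr r <> pr' r -> logn 2 j.+1 = r.+1 -> (0 < j)%N ->
  (2 * stg j <= i)%N -> (i < stg j.+1)%N -> ~~ nearby glitch H i ->
  ~ agree H (shiftn i (point pr)) (shiftn i (point pr')).
Proof.
move=> Hz ne lj j0 h1 h2 ng ag; have [si nc] := late_stage j0 h1 h2.
have := agree_trans (agree_sym (point_run z U thr ext pr ng)) (agree_trans ag (point_run z U thr ext pr' ng)).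
rewrite red_id// si /bit lj; have := typ_lt3 c2 thr ext02 i; set t := typ _ _ _ _ => t3.
have [l [lH zl]] := Hz t t3 i.
move=> /(_ l lH); rewrite /shiftn; case: (pr r) (pr' r) ne => -[] // _ e; apply: zl.
  by rewrite addn1 addSn addn0 in e.
by rewrite addn1 addSn addn0 in e.
Qed.

(** An even [j] reads no bit, and from [2 * stg j] on nothing is copied, so every parameter gives
    the same letters until the stage ends. *)
Lemma point_same pr pr' j h i : logn 2 j.+1 = 0%N -> (0 < j)%N ->
  (2 * stg j <= i)%N -> (i + h <= stg j.+1)%N ->
  agree h (shiftn i (point pr)) (shiftn i (point pr')).
Proof.
move=> lj j0 h1 h2 l lh.
have hl : (i + l < stg j.+1)%N by apply: leq_trans h2; rewrite ltn_add2l.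
have [si nc] := late_stage j0 (leq_trans h1 (leq_addr l i)) hl.
by rewrite /shiftn !pointE !red_id// /basept si /bit lj.
Qed.

Lemma point_DC1 pr pr' : pr <> pr' -> DC1_pair R (point pr) (point pr').
Proof.
move=> ne; have [r Hr] : exists r, pr r <> pr' r.
  by apply: contrapT => /forallNP no; apply: ne; apply/funext => r; exact: contrapT (no r).
have stg_inv (K : nat) j : (K <= 2 ^ j)%N -> (32 * K * stg j <= stg j.+1)%N.
  move=> Kj; apply: leq_trans (stgS_big2 c2 j).
  by rewrite leq_mul2r -[leqLHS]mulnC -[leqRHS]mulnC leq_mul2r Kj !orbT.
have small (e : R) (a n : nat) K : 0 < e -> e^-1 <= K%:R -> (0 < n)%N -> (K * a <= n)%N ->
    n%:R^-1 * a%:R <= e.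
  move=> e0 eK n0 h; rewrite ler_pdivrMl ?ltr0n// -ler_pdivrMr//.
  rewrite mulrC; apply: le_trans (_ : K%:R * a%:R <= _); first by rewrite ler_wpM2r.
  by rewrite -natrM ler_nat.
split.
  have [H HH] : exists H, forall t, (t < 3)%N -> forall m,
      exists l, (l < H)%N /\ z t (m + l)%N <> z t (m + l).+1.
    have [H0 h0] := z_nonconst (isT : (0 < 3)%N).
    have [H1 h1] := z_nonconst (isT : (1 < 3)%N).
    have [H2 h2] := z_nonconst (isT : (2 < 3)%N).
    exists (H0 + H1 + H2)%N => -[|[|[|//]]] _ m.
    - by have [l [lH zl]] := h0 m; exists l; split => //; apply: leq_trans lH _; rewrite -addnA leq_addr.
    - by have [l [lH zl]] := h1 m; exists l; split => //; apply: leq_trans lH _; rewrite addnAC leq_addl.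
    - by have [l [lH zl]] := h2 m; exists l; split => //; apply: leq_trans lH _; rewrite leq_addl.
  exists (2 ^- H); first by rewrite invr_gt0 exprn_gt0.
  apply: limn_einf_eq0; first exact: close_freq_ge0.
  move=> e n0 e0; pose K := (Num.truncn e^-1).+1.
  have [n1 Hn1] := @zero_banach_nearby _ H (glitch_zero_banach c2) (2 * K)%N.
  (* The power of 2 in [j.+1] selects bit [r], and the odd cofactor makes the stage late. *)
  pose j := (2 ^ r.+1 * (2 * (K + n0 + n1)).+1).-1.
  have jE : j.+1 = (2 ^ r.+1 * (2 * (K + n0 + n1)).+1)%N.
    by rewrite /j prednK// muln_gt0 expn_gt0.
  have lj : logn 2 j.+1 = r.+1.
    rewrite jE lognM ?expn_gt0// pfactorK// [logn 2 _]logn_coprime ?addn0//.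
    by rewrite coprime2n oddS mul2n odd_double.
  have jK : (K + n0 + n1 < j)%N.
    have : (2 * (2 * (K + n0 + n1)).+1 <= j.+1)%N.
      by rewrite jE leq_mul2r; apply/orP; right; rewrite expnS leq_pmulr// expn_gt0.
    lia.
  clearbody j; clear jE.
  have j2 := ltn_expl j (ltnSn 1).
  have jn : (j < stg j.+1)%N.
    by have := pow2_leq_stg c2 j; have := stgS_big c2 j; lia.
  exists (stg j.+1); split; first by lia.
  rewrite close_freqE; apply: (small _ _ _ K) => //; first by rewrite ltW// truncnS_gt.
    exact: stg_gt0.
  set cl := cnt _ _ _.
  (* Up to the end of the stage, close times lie before [2 * stg j] or shortly before a glitch; both
     kinds are negligible. *)
  have cl_le : (cl <= 2 * stg j + cnt (nearby glitch H) 0 (stg j.+1))%N.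
    apply: leq_trans (leq_add (_ : cnt (fun i => i < 2 * stg j)%N 0 (stg j.+1) <= _)%N (leqnn _)); last first.
      by apply: leq_trans (cnt_ltn _ _ _) _; rewrite subn0.
    apply: leq_trans (cntU _ _ _ _); apply: cnt_sub => i _ iS ci.
    apply/orP; have [|hi] := ltnP i (2 * stg j); [by left|right].
    apply: contraT => ng; exfalso.
    by apply: (point_differ HH Hr lj _ hi iS ng); [lia|exact: agree_dist ci].
  have b1 : (32 * K * stg j <= stg j.+1)%N by apply: stg_inv; lia.
  have b2 := Hn1 (stg j.+1) 0%N; rewrite -!mulnA in b1 b2.
  have : (K * cl <= K * (2 * stg j + cnt (nearby glitch H) 0 (stg j.+1)))%N.
    by rewrite leq_mul2l cl_le orbT.
  have := b2 _; rewrite mulnDr => /(_ _)/wrap[]; first by lia.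
  lia.
move=> t t0; have [h ht] := exists_pow_lt t0.
apply: limn_esup_eq1; first exact: close_freq_le1.
move=> e n0 e0; pose K := (Num.truncn e^-1).+1.
(* An even stage, where no bit is read: only the times before [2 * stg j] and the last [h] ones may
   fail to be close. *)
pose j := (2 * (K + n0 + h).+1)%N.
have lj : logn 2 j.+1 = 0%N.
  by rewrite logn_coprime// coprime2n /j oddS mul2n odd_double.
have jK : (K + n0 + h < j)%N by rewrite /j; lia.
clearbody j; have j2 := ltn_expl j (ltnSn 1).
have jn : (j < stg j)%N by have := pow2_leq_stg c2 j; lia.
have jn' := stgS_big c2 j.
exists (stg j.+1); split; first by lia.
rewrite close_freqE.
pose cl i := dist R (shiftn i (point pr)) (shiftn i (point pr')) < t; rewrite -/cl.
have n_gt0 : 0 < (stg j.+1)%:R :> R by rewrite ltr0n stg_gt0.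
have := cntC cl 0 (stg j.+1); set C := cnt cl _ _; set C' := cnt _ _ _ => CC.
have -> : 1 - (stg j.+1)%:R^-1 * C%:R = (stg j.+1)%:R^-1 * C'%:R :> R.
  have -> : C%:R = (stg j.+1)%:R - C'%:R :> R by rewrite -CC natrD addrK.
  by rewrite mulrBr mulVf ?gt_eqF// opprB addrC subrK.
apply: (small _ _ _ K) => //; first by rewrite ltW// truncnS_gt.
  exact: stg_gt0.
have C'le : (C' <= 2 * stg j + h)%N.
  rewrite -(cntC (fun i => i < stg j.+1 - h)%N 0 (stg j.+1)) in CC.
  have e1 : (cnt (predC (fun i => i < stg j.+1 - h)%N) 0 (stg j.+1) <= h)%N.
    have hS : (stg j.+1 - h + h = stg j.+1)%N by apply: subnK; lia.
    rewrite -{2}hS cntD cnt_pred0 ?add0n ?cnt_le// => i _ ih.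
    by rewrite /= negbK -ltnS.
  have e2 : (C' <= cnt (predU (fun i => i < 2 * stg j)%N (predC (fun i => i < stg j.+1 - h)%N)) 0 (stg j.+1))%N.
    apply: cnt_sub => i _ iS nc; apply/orP.
    have [|hi] := ltnP i (2 * stg j); [by left|right].
    apply: contra nc => /= hi'; apply: le_lt_trans ht; apply: dist_le.
    by apply: (point_same _ _ lj) => //; lia.
  apply: leq_trans e2 _; apply: leq_trans (cntU _ _ _ _) _; rewrite leq_add//.
  by apply: leq_trans (cnt_ltn _ _ _) _; rewrite subn0.
have b1 : (32 * K * stg j <= stg j.+1)%N by apply: stg_inv; lia.
have : (K * C' <= K * (2 * stg j + h))%N by rewrite leq_mul2l C'le orbT.
have : (K * h <= K * stg j)%N by rewrite leq_mul2l; apply/orP; right; lia.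
rewrite mulnDr -!mulnA in b1 *; lia.
Qed.

Lemma point_inj pr pr' : point pr = point pr' -> pr = pr'.
Proof.
move=> e; apply: contrapT => ne; exact: DC1_pair_neq (point_DC1 ne) e.
Qed.

Lemma points_DC1 : DC1_scrambled R (range point).
Proof.
split.
  exists (point (fun=> true)), (point (fun=> false)); split; [by exists (fun=> true)|by exists (fun=> false)|].
  by move=> /point_inj/(congr1 (@^~ 0%N)).
move=> _ _ [pr _ <-] [pr' _ <-] ne; apply: point_DC1 => e; apply: ne; by rewrite e.
Qed.

(** Cantor's diagonal argument on the parameters: [g] inverts the injection [f] along [point], and
    [d] differs from each [g n] at [n]. *)
Lemma points_uncountable : ~ countable (range point).
Proof.
move=> /countable_injP[f finj].
pose g n : nat -> bool := if pselect (exists pr, f (point pr) = n) is left ex then sval (cid ex) else fun=> true.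
pose d n := ~~ g n n.
have gd : g (f (point d)) = d.
  rewrite /g; case: pselect => [ex|[]]; last by exists d.
  case: (cid ex) => pr /= h; apply: point_inj; apply: finj h; rewrite inE; by [exists pr|exists d].
have := congr1 (@^~ (f (point d))) gd; rewrite /d.
by case: (g _ _).
Qed.

End Scrambled.

(** * Three separated minimal sequences and the scrambled families *)

Section Family.
Variables (R : realType) (k : nat) (phi : Sigma k -> R).
Hypothesis hphi : d_continuous phi.
Notation BS := (birk_sum phi).
Variables (al be : R) (U V : Sigma k) (L : nat).
Hypothesis L0 : (0 < L)%N.
Hypothesis U_low : forall P y, agree (P * L) U y -> BS y (P * L) <= al * (P * L)%:R.
Hypothesis V_high : forall P y, agree (P * L) V y -> be * (P * L)%:R <= BS y (P * L).

Definition recurrent (z : Sigma k) := forall h, exists K, forall m,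
  exists i, (i < K)%N /\ agree h z (shiftn (m + i) z).

Definition averages (z : Sigma k) (b : R) := forall d : R, 0 < d -> exists N, forall n,
  (N <= n)%N -> forall m, `|BS (shiftn m z) n - b * n%:R| <= d * n%:R.

Lemma minimal_word (b : R) (P : nat) : al < b -> b < be -> (0 < P)%N ->
  exists z, [/\ agree (P * L) U z, recurrent z & averages z b].
Proof.
move=> alb bbe P0; pose e := Num.min (b - al) (be - b).
have e0 : 0 < e by rewrite lt_min !subr_gt0 alb bbe.
have e1 : e <= b - al by rewrite ge_min lexx.
have e2 : e <= be - b by rewrite ge_min lexx orbT.
have [|z [h1 h2 h3]] := minimal_seq hphi (b := b) e0 (s0 := Level (P * L) U V).
  rewrite /= expr0 divr1; split; first by rewrite muln_gt0 P0 L0.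
    by move=> y /U_low h; apply: le_trans h _; rewrite ler_wpM2r//; lra.
  by move=> y /V_high h; apply: le_trans _ h; rewrite ler_wpM2r//; lra.
by exists z.
Qed.

(** A long prefix of [U] has average at most [al] wherever it occurs, against the uniform average
    [b > al]. *)
Lemma averages_avoid z b : al < b -> averages z b ->
  exists n0, forall P, (n0 <= P)%N -> forall m, ~ agree (P * L) U (shiftn m z).
Proof.
move=> alb av; have d0 : 0 < (b - al) / 2 by rewrite divr_gt0// subr_gt0.
have [N HN] := av _ d0; exists N.+1 => P NP m /U_low h.
have PL : (P <= P * L)%N by rewrite leq_pmulr.
have := HN (P * L)%N (leq_trans (ltnW NP) PL) m.
have n0 : 0 < (P * L)%:R :> R by rewrite ltr0n (leq_trans _ PL)// (leq_trans _ NP).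
by rewrite ler_norml => /andP[h1 _]; nra.
Qed.

(** The prefix of [U] returns in [z] within [K] steps, so it occurs in the first [K + P * L] letters
    of [y], hence in [z'], which avoids it. *)
Lemma orbit_disjoint z z' P y : agree (P * L) U z -> recurrent z ->
  (forall m, ~ agree (P * L) U (shiftn m z')) ->
  (forall h, exists m, agree h y (shiftn m z)) ->
  (forall h, exists m, agree h y (shiftn m z')) -> False.
Proof.
move=> Uz /(_ (P * L)%N)[K HK] av yz yz'.
have [m Hm] := yz (K + P * L)%N; have [m' Hm'] := yz' (K + P * L)%N.
have [i [iK Hi]] := HK m; apply: (av (m' + i)%N).
apply: agree_trans Uz _; apply: agree_trans Hi _; rewrite -!shiftnD.
apply: agree_shiftn; apply: (@agreeS _ _ (K + P * L)); first by rewrite leq_add2r ltnW.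
exact: agree_trans (agree_sym Hm) Hm'.
Qed.

(** A constant [z] that begins like [U] would have average at most [al]. So two consecutive letters
    differ somewhere, and recurrence repeats that place with bounded gaps. *)
Lemma recurrent_nonconst z b P : al < b -> (0 < P)%N -> agree (P * L) U z -> recurrent z ->
  averages z b -> exists H, forall m, exists l, (l < H)%N /\ z (m + l)%N <> z (m + l).+1.
Proof.
move=> alb P0 Uz rz av.
have [i zi] : exists i, z i <> z i.+1.
  apply: contrapT => /forallNP nc.
  have cz i : z i = z 0%N by elim: i => // i <-; symmetry; exact: contrapT (nc i).
  have sz m : shiftn m z = z by apply/funext => i; rewrite /shiftn cz [RHS]cz.
  have d0 : 0 < (b - al) / 2 by rewrite divr_gt0// subr_gt0.
  have [N HN] := av _ d0; have NL : (N <= N.+1 * L)%N by rewrite (leq_trans (leqnSn N))// leq_pmulr.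
  have := HN _ NL 0%N; rewrite shiftn0 => h.
  have h' : BS z (N.+1 * L) <= al * (N.+1 * L)%:R.
    apply: BS_blocks_le => q _; rewrite sz -[L]mul1n; apply: U_low.
    by apply: agreeS Uz; rewrite leq_mul2r P0 orbT.
  have n0 : 0 < (N.+1 * L)%:R :> R by rewrite ltr0n muln_gt0 L0.
  by move: h; rewrite ler_norml => /andP[h1 _]; nra.
have [K HK] := rz i.+2; exists (K + i)%N => m; have [j [jK Hj]] := HK m.
exists (j + i)%N; rewrite ltn_add2r; split => //.
have := Hj i (leqnSn i.+1); have := Hj i.+1 (ltnSn _).
by rewrite /shiftn addnS !addnA => <- <-.
Qed.

(** Each new sequence begins with a prefix of [U] too long to occur in the previous ones, which
    separates the orbit closures; [w] is too long for all three. *)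
Lemma minimal_family (b : nat -> R) : (forall t, (t < 3)%N -> al < b t) ->
  (forall t, (t < 3)%N -> b t < be) -> exists (z : nat -> Sigma k) (w : nat),
  [/\ (forall t, (t < 3)%N -> [/\ recurrent (z t), averages (z t) (b t) &
         exists H, forall m, exists l, (l < H)%N /\ z t (m + l)%N <> z t (m + l).+1]),
      (forall s t y, (s < 3)%N -> (t < 3)%N -> orbit_closure z s y -> orbit_closure z t y -> s = t) &
      forall t m, (t < 3)%N -> ~ agree w U (shiftn m (z t))].
Proof.
move=> bl bh.
have [z0 [U0 r0 a0]] := minimal_word (bl 0%N isT) (bh 0%N isT) (ltn0Sn 0).
have [n0 H0] := averages_avoid (bl 0%N isT) a0.
have [z1 [U1 r1 a1]] := minimal_word (bl 1%N isT) (bh 1%N isT) (ltn0Sn n0).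
have [n1 H1] := averages_avoid (bl 1%N isT) a1.
have [z2 [U2 r2 a2]] := minimal_word (bl 2%N isT) (bh 2%N isT) (ltn0Sn (n0 + n1)).
have [n2 H2] := averages_avoid (bl 2%N isT) a2.
have N1 : (n0 <= n0.+1)%N by [].
have N2 : (n0 <= (n0 + n1).+1)%N by rewrite leqW// leq_addr.
have N3 : (n1 <= (n0 + n1).+1)%N by rewrite leqW// leq_addl.
pose z t := match t with 0%N => z0 | 1%N => z1 | _ => z2 end.
exists z, ((n0 + n1 + n2) * L)%N; split.
- move=> [|[|[|//]]] _ /=; split => //.
  + exact: recurrent_nonconst (bl 0%N isT) _ U0 r0 a0.
  + exact: recurrent_nonconst (bl 1%N isT) _ U1 r1 a1.
  + exact: recurrent_nonconst (bl 2%N isT) _ U2 r2 a2.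
- move=> [|[|[|//]]] [|[|[|//]]] y _ _ //= hs ht; exfalso.
  + exact: orbit_disjoint U1 r1 (H0 _ N1) ht hs.
  + exact: orbit_disjoint U2 r2 (H0 _ N2) ht hs.
  + exact: orbit_disjoint U1 r1 (H0 _ N1) hs ht.
  + exact: orbit_disjoint U2 r2 (H1 _ N3) ht hs.
  + exact: orbit_disjoint U2 r2 (H0 _ N2) hs ht.
  + exact: orbit_disjoint U2 r2 (H1 _ N3) hs ht.
- move=> [|[|[|//]]] m _.
  + by apply: H0; rewrite -addnA leq_addr.
  + by apply: H1; rewrite addnAC leq_addl.
  + by apply: H2; rewrite leq_addl.
Qed.

Lemma scrambled_points (b : nat -> R) i : (1 <= i <= 6)%N ->
  (forall t, (t < 3)%N -> al < b t) -> (forall t, (t < 3)%N -> b t < be) ->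
  exists S : set (Sigma k), [/\ DC1_scrambled R S, ~ countable S,
    S `<=` [set x | Rec R x /\ ~ BR R x /\ case_prop R i x],
    (forall a, (forall t, (t < 3)%N -> b t = a) -> S `<=` R_phi_a phi a) &
    (b 0%N <> b 1%N -> b 2%N = b 0%N -> S `<=` I_phi phi)].
Proof.
move=> i16 bl bh; have [z [w [Hz sep junk]]] := minimal_family bl bh.
(* With this [c] the value [stg c 0 = 2 ^ (c ^ 2)] exceeds [w], so the points begin with the prefix
   of [U] that no [z t] contains. *)
pose c := (w + 2)%N; have c2 : (2 <= c)%N by rewrite /c leq_addl.
have w_le : (w <= stg c 0)%N.
  apply: leq_trans (ltnW (ltn_expl _ (ltnSn 1))); rewrite add0n /c; nia.
have rec t (t3 : (t < 3)%N) := let: And3 r _ _ := Hz t t3 in r.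
have avg t (t3 : (t < 3)%N) := let: And3 _ r _ := Hz t t3 in r.
have nc t (t3 : (t < 3)%N) := let: And3 _ _ r := Hz t t3 in r.
have E := case_ext02 i.
exists (range (point z U c2 (case_thr i) (case_ext i))); split.
- exact: (points_DC1 R U c2 _ E nc).
- exact: (points_uncountable R E nc).
- move=> _ [pr _ <-]; split; first exact: (point_Rec z U c2 _ E pr).
  split; first exact: (@point_nBR R k z U w c c2 _ _ E rec sep pr w_le junk).
  exact: (case_point R c2 w_le rec sep junk pr i16).
- move=> a ba _ [pr _ <-]; exact: (point_R_phi hphi U c2 _ E avg pr ba).
- move=> b01 b20 _ [pr _ <-].
  apply: (point_I_phi hphi (@case_thr_le4 i) E avg b01 b20).
  by rewrite /case_thr; case: ifP; case: ifP.
Qed.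

End Family.

Theorem theoremC (R : realType) (k : nat) (hk : (2 <= k)%N)
  (phi : Sigma k -> R) (hphi : d_continuous phi)
  (hI : I_phi phi !=set0) (a : R) (ha : in_IntL phi a) :
  forall i : nat, (1 <= i <= 6)%N ->
    let X := [set x | Rec R x /\ ~ BR R x /\ case_prop R i x] in
    [/\ exists S, [/\ S `<=` X `&` I_phi phi, DC1_scrambled R S
                    & ~ countable S],
        exists S, [/\ S `<=` X `&` R_phi_a phi a, DC1_scrambled R S
                    & ~ countable S]
      & exists S, [/\ S `<=` X `&` R_phi phi, DC1_scrambled R S
                    & ~ countable S]].
Proof.
have [al [be [U [V [L [ala abe L0 HU HV]]]]]] := low_high_words hphi ha.
move=> i i16 X.
(* Type 1 gets another average below [be] while types 0 and 2 keep [a], which yields divergence; the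
   constant choice below yields convergence to [a]. *)
pose b t : R := if t == 1%N then (a + be) / 2 else a.
have [S1 [dc1 un1 sX1 _ sI1]] := @scrambled_points _ _ _ hphi _ _ _ _ _ L0 HU HV b i i16
  ltac:(by move=> t _; rewrite /b; case: ifP; lra) ltac:(by move=> t _; rewrite /b; case: ifP; lra).
have [S2 [dc2 un2 sX2 sR2 _]] := @scrambled_points _ _ _ hphi _ _ _ _ _ L0 HU HV (fun=> a) i i16
  (fun _ _ => ala) (fun _ _ => abe).
have {}sR2 : S2 `<=` R_phi_a phi a by exact: sR2.
split.
- exists S1; split => // x Sx; split; first exact: sX1.
  by apply: sI1 Sx => //; rewrite /b /= => e; lra.
- by exists S2; split => // x Sx; split; [exact: sX2|exact: sR2].
(* The same set serves again, since an interior point [a] belongs to the closed interval. *)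
- exists S2; split => // x Sx; split; first exact: sX2.
  exists a; last exact: sR2.
  by move: ha => /andP[h1 h2]; apply/andP; split; exact: ltW.
Qed.
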